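(* For every real number $r\ge 1$ there exist a compact interval $[a,b]\subset\mathbb R$ (with $a<b$) and a function $f\colon[a,b]\to\mathbb R$ such that $f$ is HK$_r$-integrable on $[a,b]$ but $f$ is not P$_1$-integrable on $[a,b]$.
   Context: Throughout, $[a,b]\subset\mathbb R$ is a compact interval with $a<b$, and $r\ge1$, $s\ge 1$ are real numbers. A function in $L^r[a,b]$ here means an everywhere-defined (finite real-valued) Lebesgue measurable function $F\colon[a,b]\to\mathbb R$ with $\int_a^b|F|^r<\infty$; its values at individual points matter. Write $[w]_+=\max\{w,0\}$. ''Nearly everywhere'' means everywhere except on a countable set; ''almost everywhere'' is with respect to Lebesgue measure. **$L^r$-derivative.** $F\in L^r[a,b]$ is $L^r$-differentiable at $x\in(a,b)$ with $L^r$-derivative $F_r'(x)=\alpha\in\mathbb R$ if $$\left(\frac1h\int_{-h}^{h}|F(x+t)-F(x)-\alpha t|^r\,dt\right)^{1/r}=o(h)\quad\text{as }h\to0^+.$$ At $x=a$ the integral is taken over $[0,h]$, and at $x=b$ over $[-h,0]$. **HK$_r$-integrability.** (The following descriptive characterization of $L^r$-Henstock–Kurzweil integrability is used as the definition.) A function $f\colon[a,b]\to\mathbb R$ is HK$_r$-integrable if there exist $F\in L^r[a,b]$ and a set $E\subset[a,b]$ of Lebesgue measure zero such that: (i) $F$ is $L^r$-differentiable with $F_r'(x)=f(x)$ at every $x\in[a,b]\setminus E$; (ii) $F$ has the AC$_r$ property on $E$: for every $\varepsilon>0$ there is a function $\delta\colon E\to(0,\infty)$ such that whenever $[c_1,d_1],\dots,[c_n,d_n]$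 are nonoverlapping nondegenerate subintervals of $[a,b]$ and for each $i$ there is a point $x_i\in E\cap[c_i,d_i]$ with $[c_i,d_i]\subset(x_i-\delta(x_i),x_i+\delta(x_i))$, one has, for these points $x_i$, $$\sum_{i=1}^n\left(\frac1{d_i-c_i}\int_{c_i}^{d_i}|F(y)-F(x_i)|^r\,dy\right)^{1/r}<\varepsilon.$$ **$L^s$-continuity.** $F\in L^s[a,b]$ is $L^s$-continuous at $x\in(a,b)$ if $\left(\frac1h\int_{-h}^h|F(x+t)-F(x)|^s\,dt\right)^{1/s}\to0$ as $h\to0^+$; at $a$ the integral is over $[0,h]$ and at $b$ over $[-h,0]$. **$L^s$-derivates.** For $F\in L^s[a,b]$ and $x\in[a,b)$, the upper-right $L^s$-derivate $D_s^+F(x)$ is the infimum of all real $\alpha$ such that $$\left(\frac1h\int_0^h[F(x+t)-F(x)-\alpha t]_+^s\,dt\right)^{1/s}=o(h)\quad\text{as }h\to0^+,$$ with $D_s^+F(x)=+\infty$ if no such real $\alpha$ exists. For $x\in(a,b]$, the upper-left $L^s$-derivate $D_s^-F(x)$ is the infimum of all real $\alpha$ such that $$\left(\frac1h\int_0^h[F(x)-F(x-t)-\alpha t]_+^s\,dt\right)^{1/s}=o(h)\quad\text{as }h\to0^+,$$ with value $+\infty$ if no such real $\alpha$ exists. The upper $L^s$-derivate is $\overline D_sF(x)=\max\{D_s^+F(x),D_s^-F(x)\}$ for $x\in(a,b)$, $\overline D_sF(a)=D_s^+F(a)$, $\overline D_sF(b)=D_s^-F(b)$. **P$_s$-integrability.**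 A function $m\in L^s[a,b]$ is an $L^s$-minor function of $f\colon[a,b]\to\mathbb R$ if: $m(a)=0$; $m$ is $L^s$-continuous at every point of $[a,b]$; $\overline D_sm(x)\le f(x)$ for almost every $x\in[a,b]$; and $\overline D_sm(x)<\infty$ nearly everywhere in $[a,b]$. A function $M$ is an $L^s$-major function of $f$ if $-M$ is an $L^s$-minor function of $-f$. The function $f$ is P$_s$-integrable ($L^s$-Perron integrable) on $[a,b]$ if for every $\varepsilon>0$ there are an $L^s$-major function $M$ and an $L^s$-minor function $m$ of $f$ with $M(b)-m(b)<\varepsilon$. P$_1$-integrability is the case $s=1$. *)

(* Defs.v *)
From HB Require Import structures.
From mathcomp Require Import all_boot all_order all_algebra.
From mathcomp Require Import all_classical all_reals all_analysis.
Set Implicit Arguments.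
Unset Strict Implicit.
Unset Printing Implicit Defensive.
Import Order.TTheory GRing.Theory Num.Theory.
Import numFieldNormedType.Exports.
Local Open Scope classical_set_scope.
Local Open Scope ring_scope.

(* A function on [a, b] is represented by a total function R -> R; no definition
   below depends on its values outside [a, b] (near 0^'+ all the points at which
   the functions are evaluated lie in [a, b]).
   Measurability and integration refer to the complete Lebesgue sigma-algebra,
   not to the Borel one. The real-valued integral sends an infinite integral to
   0, but every integral over a subinterval of [a, b] below is finite for
   functions in L^r[a, b]. *)

Section definitions.
Context {R : realType}.
Implicit Types (a b r s x : R) (f F m M : R -> R) (E : set R).

Local Notation mu := (@completed_lebesgue_measure R).
(* R equipped with the Lebesgue sigma-algebra, the domain of mu *)
Local Notation lebesgueR :=
  (caratheodory_type (R := R) (mu_ext (wlength (R := R) idfun))).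

Definition in_Lr a b r F : Prop :=
  @measurable_fun _ _ lebesgueR (measurableTypeR R) `[a, b] F /\
  (\int[mu]_(x in `[a, b]) (`|F x| `^ r)%:E < +oo)%E.

(* The increments t over which a mean at x is taken: one-sided at a and b. *)
Definition window a b x (h : R) : set R :=
  if x == a then `[0, h]%classic
  else if x == b then `[- h, 0]%classic else `[- h, h]%classic.

Definition Lr_derivative_at a b r F x (alpha : R) : Prop :=
  (fun h : R => (h^-1 * \int[mu]_(t in window a b x h)
       (`|F (x + t) - F x - alpha * t| `^ r)) `^ r^-1)
    =o_ (0^'+) (fun h : R => h).

Definition AC_on a b r F E : Prop :=
  forall eps : R, 0 < eps ->
  exists2 delta : R -> R, (forall x, E x -> 0 < delta x) &
  forall (n : nat) (c d x : 'I_n -> R),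
    (forall i, [/\ a <= c i, c i < d i & d i <= b]) ->
    trivIset setT (fun i => `]c i, d i[%classic) ->
    (forall i, [/\ E (x i), x i \in `[c i, d i] &
       `[c i, d i] `<=` `]x i - delta (x i), x i + delta (x i)[]) ->
    \sum_(i < n) ((d i - c i)^-1 *
       \int[mu]_(y in `[c i, d i]) (`|F y - F (x i)| `^ r)) `^ r^-1 < eps.

Definition HK_integrable a b r f : Prop :=
  exists F E, [/\ in_Lr a b r F, E `<=` `[a, b], mu.-negligible E,
    (forall x, x \in `[a, b] -> ~ E x -> Lr_derivative_at a b r F x (f x)) &
    AC_on a b r F E].

Definition Ls_continuous_at a b s F x : Prop :=
  (h^-1 * \int[mu]_(t in window a b x h) (`|F (x + t) - F x| `^ s)) `^ s^-1
    @[h --> 0^'+] --> (0 : R).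

Definition upper_right_derivate s F x : \bar R :=
  ereal_inf [set alpha%:E | alpha in [set alpha : R |
    (fun h : R => (h^-1 * \int[mu]_(t in `[0, h])
         (Num.max (F (x + t) - F x - alpha * t) 0 `^ s)) `^ s^-1)
      =o_ (0^'+) (fun h : R => h)]].

Definition upper_left_derivate s F x : \bar R :=
  ereal_inf [set alpha%:E | alpha in [set alpha : R |
    (fun h : R => (h^-1 * \int[mu]_(t in `[0, h])
         (Num.max (F x - F (x - t) - alpha * t) 0 `^ s)) `^ s^-1)
      =o_ (0^'+) (fun h : R => h)]].

Definition upper_derivate a b s F x : \bar R :=
  if x == a then upper_right_derivate s F x
  else if x == b then upper_left_derivate s F x
  else maxe (upper_right_derivate s F x) (upper_left_derivate s F x).

Definition minor_function a b s f m : Prop :=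
  [/\ in_Lr a b s m,
      m a = 0,
      (forall x, x \in `[a, b] -> Ls_continuous_at a b s m x),
      {ae mu, forall x, x \in `[a, b] ->
         (upper_derivate a b s m x <= (f x)%:E)%E} &
      countable [set x | x \in `[a, b] /\
         ~ (upper_derivate a b s m x < +oo)%E]].

Definition major_function a b s f M : Prop :=
  minor_function a b s (fun x => - f x) (fun x => - M x).

Definition Perron_integrable a b s f : Prop :=
  forall eps : R, 0 < eps -> exists M m,
    [/\ major_function a b s f M, minor_function a b s f m & M b - m b < eps].

End definitions.

(* Main.v *)
Require Import Defs.
From mathcomp Require Import all_boot all_order all_algebra.
From mathcomp Require Import all_classical all_reals all_analysis.
From mathcomp Require Import measurable_realfun ring lra zify.
Set Implicit Arguments.
Unset Strict Implicit.
Unset Printing Implicit Defensive.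
Import Order.TTheory GRing.Theory Num.Theory.
Import numFieldNormedType.Exports.
Local Open Scope classical_set_scope.
Local Open Scope ring_scope.

(** The counterexample is the derivative of a function [hump] that vanishes on a
    null Cantor-like set, the dust, and carries differentiable bumps of height
    comparable to 1 in the gaps of the dust. At stage [n] there are [2 ^ n] nodes [q]; the
    part of the dust that belongs to [q] lies in [q, q + 2 * len n], and the bump
    of [q] is centred at [q + 3 * len n] with half-width [len n.+1]. Here
    [len n = kappa ^+ (n ^ 2)] with a small [kappa] that depends on [r].

    On the one hand [len n.+1 / len n] is so small that its [r]-th root, times
    the number of bumps at stage [n], is summable. An interval that meets the
    dust and a bump of stage [n] is longer than [len n / 2], so that the mean
    oscillation of [hump] on it is small, and it contains an end of this bump;
    nonoverlapping intervals cannot share such an end. Summing over the ends of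
    all bumps proves the AC property on the dust ([AC_hump]). Away from the dust
    [hump] is differentiable, hence its derivative is integrable in the sense of
    Henstock and Kurzweil with exponent [r] ([hump_HK]).

    On the other hand [len n.+1 / len n ^+ 2] tends to infinity: seen from a point
    of the dust, an increment that does not vanish persists on a set too large for
    a finite upper right derivate, even in the mean of order 1 ([hump_steep]).

    This rules out minor functions altogether ([no_minor_function]). Let [m] be
    one and let [G] be the indefinite integral of [g = m - hump]. Continuity in
    mean makes [g] the derivative of [G] everywhere, and the bounds on the upper
    right derivate of [m] become bounds [G (x + h) <= G x + h * g x + K * h ^+ 2]
    for small positive [h], where [K] is arbitrarily small for almost all [x] and
    finite for all but countably many [x]. At points of the dust only the sign of
    [hump] matters, since it is nonnegative and vanishes there. Such bounds force
    [g] to be nonincreasing ([nonincreasing_of_right_derivate]): otherwise [G]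
    would have a supporting line of every slope in some interval, but at the
    contact points the bounds make [g] Lipschitz on countably many null sets, and
    these and the countable exceptional set have null images. A monotone
    derivative is continuous, so near a point of the dust the increments of [m]
    are those of [hump] up to a small error, and the upper right derivate of [m]
    is infinite at every point of the dust outside a countable set. As the dust is
    uncountable, this is a contradiction; and a Perron integrable function has
    minor functions. *)

(** Linear arithmetic from the order hypotheses alone: atoms are compared up to
    conversion, which is prohibitive for integrals and local definitions. *)
Ltac order_lra :=
  repeat match goal with x := _ |- _ => clearbody x end;
  repeat match goal with H : ?P |- _ =>
    lazymatch type of P with
    | Prop => lazymatch P with
              | context [@Rintegral _ _ _ _ _ _] => clear H
              | is_true (Order.le _ _) => fail
              | is_true (Order.lt _ _) => fail
              | is_true (andb _ _) => fail
              | _ => clear H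
              end
    end end; lra.

(** * Translation invariance of the completed Lebesgue measure *)

Section completed_lebesgue.
Context {R : realType}.
Local Notation mu := (@completed_lebesgue_measure R).
Local Notation lebesgueR :=
  (caratheodory_type (R := R) (mu_ext (wlength (R := R) idfun))).

Lemma borel_lebesgue_measurable (A : set R) :
  @measurable _ (measurableTypeR R) A -> @measurable _ lebesgueR A.
Proof. exact: sub_caratheodory. Qed.

Lemma completed_lebesgueE (A : set R) : mu A = lebesgue_measure A.
Proof. by []. Qed.

Lemma itv_lebesgue_measurable (i : interval R) :
  @measurable _ lebesgueR [set` i].
Proof. by apply: borel_lebesgue_measurable; exact: measurable_itv. Qed.

Lemma completed_lebesgue_set1 (x : R) : mu [set x] = 0%E.
Proof. exact: lebesgue_measure_set1. Qed.

Lemma completed_lebesgue_cc (c d : R) : c <= d -> mu `[c, d] = (d - c)%:E.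
Proof.
move=> cd; rewrite completed_lebesgueE lebesgue_measure_itv /= lte_fin.
by move: cd; rewrite le_eqVlt => /predU1P[->|->]; rewrite ?ltxx ?subrr -?EFinB.
Qed.

Lemma mu_ext_shift_le (x : R) (A : set R) :
  (mu ((fun t => x + t)%R @^-1` A) <= mu A)%E.
Proof.
apply: le_ereal_inf_tmp => _ [B [mB AB] <-].
have shiftE (a b : R) : (fun t => x + t) @^-1` `]a, b] = `]a - x, b - x]%classic.
  by apply/seteqP; split => t; rewrite /= !in_itv/= ltrBlDl lerBrDl.
apply: ereal_inf_lbound; exists (fun k => (fun t => x + t) @^-1` (B k)).
  split; last by move=> t /AB [k _ ?]; exists k.
  by move=> k; have [[a b] _ /= <-] := mB k; rewrite shiftE; exact: is_ocitv.
apply: eq_eseriesr => k _.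
have [[a b] _ /= <-] := mB k.
rewrite shiftE !wlength_itv/= !lte_fin ltrD2r; case: ifP => // _.
by rewrite -!EFinB; congr EFin; ring.
Qed.

(** A cover by half-open intervals translates to a cover with the same total
    length, so the outer measure is invariant for arbitrary sets. *)
Lemma completed_lebesgue_shift (x : R) (A : set R) :
  mu ((fun t => x + t) @^-1` A) = mu A.
Proof.
apply/eqP; rewrite eq_le mu_ext_shift_le/=.
have := mu_ext_shift_le (- x) ((fun t => x + t) @^-1` A).
rewrite -comp_preimage (_ : _ \o _ = id) ?preimage_id//.
by apply/funext => t /=; rewrite addNKr.
Qed.

(** The criterion of Caratheodory involves the outer measure only, hence it
    inherits translation invariance. *)
Lemma measurable_shift (x : R) :
  measurable_fun setT (fun t : lebesgueR => x + t : lebesgueR).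
Proof.
move=> _ A mA; rewrite setTI.
have {}mA : caratheodory_measurable mu A := mA.
suff : caratheodory_measurable mu ((fun t : R => x + t) @^-1` A) by [].
pose s : set R -> set R := fun B => (fun t => x + t) @^-1` B.
move=> X; pose Y := (fun t => - x + t) @^-1` X.
have -> : X = s Y.
  by rewrite /s /Y -comp_preimage (_ : _ \o _ = id) ?preimage_id//;
    apply/funext => t /=; rewrite addKr.
have muE B : mu (s B) = mu B by exact: completed_lebesgue_shift.
by rewrite muE (mA Y) -(muE (Y `&` A)) -(muE (Y `&` ~` A)).
Qed.
End completed_lebesgue.

Section shift_integral.
Context {R : realType}.
Local Notation mu := (@completed_lebesgue_measure R).
Local Notation lebesgueR :=
  (caratheodory_type (R := R) (mu_ext (wlength (R := R) idfun))).
Implicit Types (g : R -> R) (x p q : R).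

Lemma shift_itv x p q :
  (fun t : R => x + t) @^-1` `[x + p, x + q] = `[p, q]%classic.
Proof. by apply/seteqP; split => t; rewrite /= !in_itv/= !lerD2l. Qed.

(** Translation pushes the measure forward to itself. *)
Lemma ge0_integral_shift x (D : set lebesgueR) (f : lebesgueR -> \bar R) :
  measurable D -> measurable_fun D f ->
  (forall y, D y -> (0 <= f y)%E) ->
  (\int[mu]_(y in D) f y =
   \int[mu]_(t in (fun t : R => x + t)%R @^-1` D) f (x + t)%R)%E.
Proof.
move=> mD mf f0.
have f0' : {in D, forall y, (0 <= f y)%E} by move=> y /set_mem; exact: f0.
have pushE : pushforward mu (fun t : lebesgueR => x + t : lebesgueR) = mu.
  by apply/funext => A; exact: completed_lebesgue_shift.
by rewrite -[RHS](ge0_integral_pushforward (measurable_shift x) mu mD mf f0') pushE.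
Qed.

Lemma measurable_fun_shift x (D : set R) (f : R -> R) :
  @measurable _ lebesgueR D ->
  @measurable_fun _ _ lebesgueR (measurableTypeR R) D f ->
  @measurable_fun _ _ lebesgueR (measurableTypeR R)
    ((fun t => x + t) @^-1` D) (fun t => f (x + t)).
Proof.
move=> mD mf mE A mA.
rewrite (_ : _ `&` _ = (fun t => x + t) @^-1` (D `&` f @^-1` A))//.
rewrite -[X in measurable X]setTI.
by apply: measurable_shift => //; exact: mf.
Qed.

Lemma integrable_shift g x p q :
  mu.-integrable `[x + p, x + q] (EFin \o g) ->
  mu.-integrable `[p, q] (EFin \o (fun t => g (x + t))).
Proof.
have mI := @itv_lebesgue_measurable R `[x + p, x + q].
move=> /integrableP[mg ig]; apply/integrableP; split.
  apply/measurable_EFinP; rewrite -(shift_itv x).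
  by apply: measurable_fun_shift mI _; apply/measurable_EFinP.
rewrite -(shift_itv x).
have mabs : measurable_fun (`[x + p, x + q] : set lebesgueR) (abse \o (EFin \o g)).
  exact: measurableT_comp.
by rewrite -(ge0_integral_shift x mI mabs (fun _ _ => abse_ge0 _)).
Qed.

Lemma Rintegral_shift g x p q :
  mu.-integrable `[x + p, x + q] (EFin \o g) ->
  \int[mu]_(t in `[p, q]) g (x + t) = \int[mu]_(y in `[x + p, x + q]) g y.
Proof.
have mI := @itv_lebesgue_measurable R `[x + p, x + q].
move=> /integrableP[mg ig]; rewrite /Rintegral; congr fine.
rewrite integralE [RHS]integralE.
rewrite (@ge0_integral_shift x `[x + p, x + q] ((EFin \o g)^\+)%E)//; last first.
  exact: measurable_funepos.
rewrite (@ge0_integral_shift x `[x + p, x + q] ((EFin \o g)^\-)%E)//; last first.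
  exact: measurable_funeneg.
rewrite shift_itv; congr (_ - _)%E; apply: eq_integral => t _.
  by rewrite !funeposE.
by rewrite !funenegE.
Qed.

Lemma integrable_sub_itv g (a b c d : R) :
  mu.-integrable `[a, b] (EFin \o g) -> a <= c -> d <= b ->
  mu.-integrable `[c, d] (EFin \o g).
Proof.
move=> ig ac db; apply: integrableS ig; try exact: itv_lebesgue_measurable.
by apply: subset_itv; rewrite bnd_simp.
Qed.

Lemma Rintegral_itv_increment g (a b x y : R) :
  mu.-integrable `[a, b] (EFin \o g) -> a <= x -> x <= y -> y <= b ->
  \int[mu]_(t in `[a, y]) g t - \int[mu]_(t in `[a, x]) g t =
  \int[mu]_(t in `[x, y]) g t.
Proof.
move=> ig ax xy yb.
have igS (i : interval R) : [set` i] `<=` `[a, b] ->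
    mu.-integrable [set` i] (EFin \o g).
  by move=> ib; apply: integrableS ig => //; exact: itv_lebesgue_measurable.
have mi (i : interval R) := @itv_lebesgue_measurable R i.
have split1 : `[a, y]%classic = `[a, x] `|` `]x, y].
  by rewrite -itv_bndbnd_setU// bnd_simp.
have split2 : `[x, y]%classic = [set x] `|` `]x, y].
  by rewrite setU1itv// bnd_simp.
rewrite split1 Rintegral_setU//; last 2 first.
  by rewrite -split1; apply: igS; apply: subset_itvl; rewrite bnd_simp.
  apply/disj_setPS => z [/=]; rewrite !in_itv/= => /andP[_ zx] /andP[].
  by rewrite ltNge zx.
rewrite split2 Rintegral_setU//; last 3 first.
- by apply: borel_lebesgue_measurable.
- by rewrite -split2; apply: igS; apply: subset_itv; rewrite bnd_simp.
- by apply/disj_setPS => z [/= ->]; rewrite in_itv/= ltxx.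
rewrite addrC addKr [X in _ = X + _](_ : _ = 0) ?add0r//.
rewrite (@eq_Rintegral _ _ _ _ _ (cst (g x))); last first.
  by move=> z; rewrite inE => /= ->.
rewrite Rintegral_cst; last by apply: borel_lebesgue_measurable.
by rewrite [X in _ * fine X](completed_lebesgue_set1 x) mulr0.
Qed.
End shift_integral.

(** * Limits on the right of 0 and derivatives *)

Section epsilon_delta.
Context {R : realType}.
Implicit Types (P : R -> Prop) (G : R -> R) (x k : R).

Lemma near_at_right0 P : (\forall h \near 0^'+, P h) <->
  exists2 d : R, 0 < d & forall h, 0 < h -> h < d -> P h.
Proof.
split=> [|[d d0 H]].
  rewrite near_withinE => /nbhs_ballP[d d0 H]; exists d => // h h0 hd.
  by apply: H => //; rewrite /ball/= sub0r normrN gtr0_norm.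
near=> h; apply: H => //; near: h; exact: nbhs_right_lt.
Unshelve. all: by end_near. Qed.

Lemma littleo_right0 (u : R -> R) :
  (u =o_ (0^'+) (fun h : R => h)) <->
  (forall e : R, 0 < e -> exists2 d : R, 0 < d &
     forall h : R, 0 < h -> h < d -> `|u h| <= e * h).
Proof.
rewrite eqoP; split=> H e e0.
  have /near_at_right0[d d0 {}H] := H _ e0.
  by exists d => // h h0 /H; rewrite (gtr0_norm h0); apply.
have [d d0 {}H] := H _ e0; apply/near_at_right0; exists d => // h h0 hd.
by rewrite (gtr0_norm h0) H.
Qed.

Lemma is_derive_eps G x k :
  (forall e : R, 0 < e -> exists2 d : R, 0 < d & forall h : R, h != 0 -> `|h| < d ->
     `|G (x + h) - G x - h * k| <= e * `|h|) -> is_derive x 1 G k.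
Proof.
move=> H.
have cG : h^-1 *: (G (h *: 1 + x) - G x) @[h --> 0^'] --> k.
  apply/cvgrPdist_le => e e0; have [d d0 Hd] := H _ e0.
  rewrite near_withinE; apply/nbhs_ballP; exists d => //= h.
  rewrite /ball/= sub0r normrN => hd h0.
  have h0' : 0 < `|h| by rewrite normr_gt0.
  rewrite -(ler_pM2r h0') -normrM.
  have -> : (k - h^-1 *: (G (h *: 1 + x) - G x)) * h
          = - (G (x + h) - G x - h * k).
    by rewrite /GRing.scale/= mulr1 (addrC x); field.
  by rewrite normrN; exact: Hd.
apply: DeriveDef; last exact: cvg_lim.
by apply/cvg_ex; exists k.
Qed.

Lemma is_deriveP_eps G x k (e : R) : is_derive x 1 G k -> 0 < e ->
  exists2 d : R, 0 < d & forall h : R, `|h| < d ->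
     `|G (x + h) - G x - h * k| <= e * `|h|.
Proof.
move=> [dG <-] e0.
have /cvgrPdist_le/(_ _ e0) : h^-1 *: (G (h *: 1 + x) - G x) @[h --> 0^'] --> 'D_1 G x.
  exact: dG.
rewrite near_withinE => /nbhs_ballP[d d0 H]; exists d => // h hd.
have [->|h0] := eqVneq h 0; first by rewrite addr0 mul0r !subrr normr0 mulr0.
have := H h; rewrite /ball/= sub0r normrN => /(_ hd h0).
have h0' : 0 < `|h| by rewrite normr_gt0.
rewrite -(ler_pM2r h0') -normrM.
have -> // : ('D_1 G x - h^-1 *: (G (h *: 1 + x) - G x)) * h
        = - (G (x + h) - G x - h * 'D_1 G x).
  by rewrite /GRing.scale/= mulr1 (addrC x); field.
by rewrite normrN.
Qed.
End epsilon_delta.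

(** * Monotonicity from second-order bounds on the right *)

Section null_image.
Context {R : realType}.
Local Notation mu := (@completed_lebesgue_measure R).
Implicit Types (A : set R) (g : R -> R).

Lemma le_completed_lebesgue A (B : set R) : A `<=` B -> (mu A <= mu B)%E.
Proof. exact: (@le_mu_ext _ (ocitv_type R) R (wlength idfun) A B). Qed.

Lemma completed_lebesgue_bigcup_le (F : (set R)^nat) :
  (mu (\bigcup_n F n) <= \sum_(n <oo) mu (F n))%E.
Proof. by apply: mu_ext_sigma_subadditive; exact: wlength_ge0. Qed.

Lemma completed_lebesgue_ge0 A : (0 <= mu A)%E.
Proof. by apply: mu_ext_ge0; exact: wlength_ge0. Qed.

Lemma negligible_completed_lebesgue A : mu.-negligible A -> mu A = 0%E.
Proof.
move=> [B [mB B0 AB]]; apply/eqP; rewrite eq_le completed_lebesgue_ge0 andbT.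
by rewrite -B0 le_completed_lebesgue.
Qed.

(** Cover [A] by half-open intervals of total length less than [e], hence each
    shorter than [d]. The image of the part of [A] in an interval of length [l]
    lies in an interval of length [2 * L * l]. *)
Lemma lipschitz_null_image g A (L d : R) : 0 <= L -> 0 < d -> mu A = 0%E ->
  (forall z w, A z -> A w -> z <= w -> w - z < d -> `|g w - g z| <= L * (w - z)) ->
  mu (g @` A) = 0%E.
Proof.
move=> L0 d0 A0 gL.
suff H (e : R) : 0 < e -> e <= d -> (mu (g @` A) <= (2 * L * e)%:E)%E.
  apply/eqP; rewrite eq_le completed_lebesgue_ge0 andbT.
  apply/lee_addgt0Pr => e e0; rewrite add0e.
  have c0 : 0 < 2 * L + 1 by lra.
  have e1 : 0 < Num.min d (e / (2 * L + 1)) by rewrite lt_min d0 divr_gt0.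
  apply: (le_trans (H _ e1 _)); first by rewrite ge_min lexx.
  rewrite lee_fin (@le_trans _ _ ((2 * L + 1) * (e / (2 * L + 1))))//.
    apply: ler_pM; [lra|exact: ltW|lra|by rewrite ge_min lexx orbT].
  by rewrite mulrC mulfVK// gt_eqF.
move=> e0 ed.
have : (mu A < e%:E)%E by rewrite A0 lte_fin.
move=> /ereal_inf_lt[_ [B [mB AB] <-]] Be.
have Bab k : exists ab : R * R, B k = `]ab.1, ab.2]%classic.
  by have [ab _ <-] := mB k; exists ab.
have Bd k : (wlength idfun (B k) < d%:E)%E.
  apply: (@lt_le_trans _ _ e%:E); last by rewrite lee_fin.
  apply: le_lt_trans Be; rewrite (@nneseriesD1 _ _ k)//.
  apply: leeDl; apply: nneseries_ge0 => n _ _; exact: wlength_ge0.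
have gAB : g @` A `<=` \bigcup_k g @` (A `&` B k).
  by move=> _ [z Az <-]; have [k _ Bz] := AB _ Az; exists k => //; exists z.
apply: le_trans (le_completed_lebesgue gAB) _.
apply: le_trans (completed_lebesgue_bigcup_le _) _.
apply: (@le_trans _ _ (\sum_(k <oo) (2 * L)%:E * wlength idfun (B k))%E); last first.
  rewrite nneseriesZl; last by move=> k _; exact: wlength_ge0.
  rewrite [leRHS]EFinM; apply: lee_wpmul2l; last exact: ltW.
  by rewrite lee_fin mulr_ge0.
apply: lee_nneseries => [k _ _|k _]; first exact: completed_lebesgue_ge0.
have [AB0|/set0P[z [Az Bz]]] := eqVneq (A `&` B k) set0.
  rewrite AB0 image_set0 [X in (X <= _)%E](_ : _ = 0%E); last first.
    by apply: mu_ext0; [exact: wlength0|exact: wlength_ge0].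
  by rewrite mule_ge0 ?wlength_ge0// lee_fin mulr_ge0.
have [[p q] /= Bpq] := Bab k; have := Bd k.
have pq : p < q by move: Bz; rewrite Bpq /= in_itv/= => /andP[]; exact: lt_le_trans.
rewrite Bpq wlength_itv/= lte_fin pq -EFinB lte_fin => pqd.
have sub : g @` (A `&` B k) `<=` `[g z - L * (q - p), g z + L * (q - p)].
  move=> _ [w [Aw Bw] <-]; move: Bz Bw; rewrite Bpq /= !in_itv/= => /andP[? ?] /andP[? ?].
  rewrite -ler_distl.
  have [zw|wz] := leP z w.
    by apply: le_trans (gL _ _ Az Aw zw _) _; [lra|rewrite ler_wpM2l//; lra].
  rewrite distrC.
  by apply: le_trans (gL _ _ Aw Az (ltW wz) _) _; [lra|rewrite ler_wpM2l//; lra].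
rewrite -Bpq; apply: le_trans (le_completed_lebesgue sub) _.
have Lpq : 0 <= L * (q - p) by rewrite mulr_ge0//; lra.
rewrite completed_lebesgue_cc; last by lra.
by rewrite -EFinM lee_fin; lra.
Qed.
End null_image.

Section monotonicity.
Context {R : realType}.
Local Notation mu := (@completed_lebesgue_measure R).
Implicit Types (G g : R -> R) (x y z k : R) (C N : set R).

Lemma right_min_slope G g y z k : z < y -> is_derive z 1 G (g z) ->
  (forall w, z <= w <= y -> G z + k * (w - z) <= G w) -> k <= g z.
Proof.
move=> zy dG Gk; rewrite leNgt; apply/negP => gk.
have e0 : 0 < (k - g z) / 2 by lra.
have [d d0 Hd] := is_deriveP_eps dG e0.
pose h := Num.min (d / 2) (y - z).
have h0 : 0 < h by rewrite lt_min; apply/andP; split; lra.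
have hd : h <= d / 2 by rewrite ge_min lexx.
have hy : h <= y - z by rewrite ge_min lexx orbT.
have := Hd h; rewrite (gtr0_norm h0) => /(_ ltac:(lra)).
rewrite ler_norml => /andP[_].
have := Gk (z + h) ltac:(lra); nra.
Qed.

Lemma left_min_slope G g x z k : x < z -> is_derive z 1 G (g z) ->
  (forall w, x <= w <= z -> G z + k * (w - z) <= G w) -> g z <= k.
Proof.
move=> xz dG Gk; rewrite leNgt; apply/negP => gk.
have e0 : 0 < (g z - k) / 2 by lra.
have [d d0 Hd] := is_deriveP_eps dG e0.
pose h := Num.min (d / 2) (z - x).
have h0 : 0 < h by rewrite lt_min; apply/andP; split; lra.
have hd : h <= d / 2 by rewrite ge_min lexx.
have hy : h <= z - x by rewrite ge_min lexx orbT.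
have := Hd (- h); rewrite normrN (gtr0_norm h0) => /(_ ltac:(lra)).
rewrite ler_norml => /andP[_].
have := Gk (z - h) ltac:(lra); nra.
Qed.

(** The function [G w - k * w] attains its minimum on [x, y] at an interior point,
    because it decreases at [x] and increases at [y]. *)
Lemma supporting_slope G g x y k : x < y ->
  (forall z, x <= z <= y -> is_derive z 1 G (g z)) -> g x < k < g y ->
  exists z, [/\ x < z < y, g z = k &
    forall w, x <= w <= y -> G z + k * (w - z) <= G w].
Proof.
move=> xy dG /andP[gxk kgy].
have [|z zxy Hz] := @EVT_min R (fun w => G w - k * w) x y (ltW xy).
  apply: derivable_within_continuous => w; rewrite in_itv/= => wxy.
  have dw := dG w wxy.
  have [] // : is_derive w 1 (fun w => G w - k * w) (g w - k).
  by apply: is_derive_eq; rewrite /GRing.scale/=; ring.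
have {}Hz w : x <= w <= y -> G z + k * (w - z) <= G w.
  by move=> wxy; have := Hz w; rewrite in_itv/= => /(_ wxy); lra.
move: zxy; rewrite in_itv/= => zxy.
have dGz := dG z zxy.
have [xz zy] : x < z /\ z < y.
  have /andP[] := zxy; rewrite !le_eqVlt => /predU1P[xz|xz] /predU1P[zy|zy]//.
  - lra.
  - have := @right_min_slope G g y z k zy dGz.
    rewrite -xz => /(_ _)/wrap[w wz|]; last lra.
    by rewrite xz; apply: Hz; lra.
  - have := @left_min_slope G g x z k xz dGz.
    rewrite zy => /(_ _)/wrap[w wz|]; last lra.
    by rewrite -zy; apply: Hz; lra.
exists z; split; [lra| |exact: Hz].
apply/eqP; rewrite eq_le; apply/andP; split.
  by apply: (left_min_slope xz dGz) => w wz; apply: Hz; lra.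
by apply: (right_min_slope zy dGz) => w wz; apply: Hz; lra.
Qed.

(** If [g x < g y], every [k] strictly between is the slope of a supporting line of
    [G] on [x, y], at a point [z] with [g z = k]. The strict upper bound excludes
    [z] from the complement of [C `|` N]. The points [z] of [N] are sorted into
    countably many sets [A n] by the constants in their quadratic bounds. On [A n]
    the function [g] is nondecreasing, by the supporting lines, and Lipschitz, by
    comparing the supporting line of the right point with the quadratic bound of the
    left one. So the slopes, which fill the interval from [g x] to [g y], would form
    a null set. *)
Lemma nonincreasing_of_right_strict G g a b C N : countable C -> mu N = 0%E ->
  (forall z, a < z < b -> is_derive z 1 G (g z)) ->
  (forall z, a < z < b -> ~ C z -> ~ N z -> exists2 d : R, 0 < d &
    forall h : R, 0 < h -> h < d -> G (z + h) < G z + h * g z) ->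
  (forall z, a < z < b -> ~ C z -> exists K d : R, 0 < d /\
    forall h : R, 0 < h -> h < d -> G (z + h) <= G z + h * g z + K * h ^+ 2) ->
  forall x y, a < x -> x <= y -> y < b -> g y <= g x.
Proof.
move=> cC N0 dG strictG boundG x y ax xy yb.
rewrite leNgt; apply/negP => gxy.
have {}xy : x < y.
  by rewrite lt_neqAle xy andbT; apply: contraTneq gxy => ->; rewrite ltxx.
pose supp z := forall w, x <= w <= y -> G z + g z * (w - z) <= G w.
pose A n := [set z | [/\ x < z, z + n.+1%:R^-1 < y, supp z &
  forall h : R, 0 < h -> h < n.+1%:R^-1 ->
    G (z + h) <= G z + h * g z + n.+1%:R * h ^+ 2] /\ N z].
have gA0 n : mu (g @` A n) = 0%E.
  have n0 : 0 < n.+1%:R :> R by rewrite ltr0n.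
  have n1 : 0 < n.+1%:R^-1 :> R by rewrite invr_gt0.
  apply: (@lipschitz_null_image R g (A n) (4 * n.+1%:R) (n.+1%:R^-1 / 2)).
  - by rewrite mulr_ge0// ltW.
  - by rewrite divr_gt0.
  - apply/eqP; rewrite eq_le completed_lebesgue_ge0 andbT -N0.
    by apply: le_completed_lebesgue => z [].
  - move=> z w [[xz zy sz bz] _] [[xw wy sw _] _] zw wz.
    set q := n.+1%:R^-1 in n1 zy bz wy wz; clearbody q.
    set K := n.+1%:R in n0 bz *; clearbody K.
    move: zw; rewrite le_eqVlt => /predU1P[->|zw]; first by rewrite !subrr mulr0 normr0.
    set h := w - z in wz *.
    have h0 : 0 < h by rewrite /h; lra.
    (* The supporting line at z, taken at w; the one at w, taken at z and at
       z + 2h; and the quadratic bound at z for the increment 2h. *)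
    have := sz w ltac:(lra); have := sw z ltac:(lra).
    have := sw (z + 2 * h) ltac:(rewrite /h in wz *; lra).
    have := bz (2 * h) ltac:(lra) ltac:(lra).
    have -> : z + 2 * h - w = h by rewrite /h; ring.
    have -> : z - w = - h by rewrite /h; ring.
    rewrite -/h => H1 H2 H3 H4.
    rewrite ler_norml; apply/andP; split.
      have : 0 <= h * (g w - g z) by lra.
      rewrite pmulr_rge0// => ?; apply: (@le_trans _ _ 0) => //.
      by rewrite oppr_le0 !mulr_ge0//; lra.
    rewrite -(ler_pM2l h0); lra.
have cover : `]g x, g y[ `<=` \bigcup_n g @` A n `|` g @` C.
  move=> k; rewrite /= in_itv/= => kxy.
  have [|z [/andP[xz zy] gz sz]] := @supporting_slope G g x y k xy _ kxy.
    by move=> z zxy; apply: dG; lra.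
  rewrite -gz in sz *.
  have [Cz|nCz] := pselect (C z); first by right; exists z.
  have zab : a < z < b by lra.
  have [Nz|nNz] := pselect (N z); last first.
    have [d d0 Hd] := strictG z zab nCz nNz.
    pose h := Num.min (d / 2) (y - z).
    have h0 : 0 < h by rewrite lt_min; apply/andP; split; lra.
    have hd : h <= d / 2 by rewrite ge_min lexx.
    have hy : h <= y - z by rewrite ge_min lexx orbT.
    by have := Hd h h0 ltac:(lra); have := sz (z + h) ltac:(lra); lra.
  left; have [K [d [d0 Hd]]] := boundG z zab nCz.
  pose e := Num.min d (y - z).
  have e0 : 0 < e by rewrite lt_min d0; lra.
  near \oo => n; exists n => //; exists z => //; split=> //.
  have ne : n.+1%:R^-1 < e by near: n; exact: near_infty_natSinv_lt (PosNum e0).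
  move: ne; rewrite lt_min => /andP[nd ny].
  set q := n.+1%:R^-1 in nd ny *; clearbody q.
  split=> //; first lra.
  move=> h h0 hn; apply: le_trans (Hd h h0 _) _; first lra.
  rewrite lerD2l ler_wpM2r ?sqr_ge0//.
  apply: (@le_trans _ _ n%:R); last by rewrite ler_nat.
  by near: n; exact: nbhs_infty_ger.
have : (mu `]g x, g y[ <= 0)%E.
  apply: le_trans (le_completed_lebesgue cover) _.
  have -> : \bigcup_n g @` A n `|` g @` C =
    \bigcup_n (if n is n'.+1 then g @` A n' else g @` C).
    apply/seteqP; split.
      by move=> k [[n _ ?]|?]; [exists n.+1|exists 0%N].
    by move=> k [[|n] _ ?]; [right|left; exists n].
  apply: le_trans (completed_lebesgue_bigcup_le _) _.
  rewrite eseries0// => -[_ _|n _ _]; last exact: gA0.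
  by apply: countable_lebesgue_measure0; exact: card_le_trans (card_image_le g C) cC.
rewrite completed_lebesgueE lebesgue_measure_itv/= lte_fin gxy -EFinB lee_fin.
lra.
Unshelve. all: by end_near. Qed.

(** Subtracting [t * z ^+ 2] from [G] makes the bound strict outside [N]. *)
Lemma nonincreasing_of_right_derivate G g a b C N : countable C -> mu N = 0%E ->
  (forall z, a < z < b -> is_derive z 1 G (g z)) ->
  (forall z, a < z < b -> ~ C z -> ~ N z -> forall e : R, 0 < e -> exists2 d : R,
    0 < d & forall h : R, 0 < h -> h < d -> G (z + h) <= G z + h * g z + e * h ^+ 2) ->
  (forall z, a < z < b -> ~ C z -> exists K d : R, 0 < d /\
    forall h : R, 0 < h -> h < d -> G (z + h) <= G z + h * g z + K * h ^+ 2) ->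
  forall x y, a < x -> x <= y -> y < b -> g y <= g x.
Proof.
move=> cC N0 dG aeG boundG x y ax xy yb.
apply/ler_addgt0Pr => /= e e0; move: (e : R) e0 => {}e e0.
pose t : R := e / (2 * (y - x + 1)).
have t0 : 0 < t by rewrite divr_gt0//; lra.
have := @nonincreasing_of_right_strict (fun z : R => G z - t * z ^+ 2)
  (fun z : R => g z - 2 * t * z) a b C N cC N0 _ _ _ x y ax xy yb.
have te : 2 * t * (y - x) <= e.
  have yx : y - x + 1 != 0 by apply/eqP; lra.
  have <- : 2 * t * (y - x + 1) = e by rewrite /t; field; exact: yx.
  lra.
move=> /(_ _ _ _)/wrap[].
- move=> z zab; have dGz := dG z zab.
  apply: is_derive_eq; rewrite /GRing.scale/=; ring.
- move=> z zab nC nN; have [d d0 Hd] := aeG z zab nC nN (t / 2) ltac:(lra).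
  exists d => // h h0 hd; have := Hd h h0 hd.
  have : 0 < t * h ^+ 2 by rewrite mulr_gt0// exprn_gt0.
  lra.
- move=> z zab nC; have [K [d [d0 Hd]]] := boundG z zab nC.
  exists (K - t), d; split=> // h h0 hd; have := Hd h h0 hd; lra.
lra.
Qed.
End monotonicity.

(** * Integrals over intervals *)

Section L1_calculus.
Context {R : realType}.
Local Notation mu := (@completed_lebesgue_measure R).
Local Notation lebesgueR :=
  (caratheodory_type (R := R) (mu_ext (wlength (R := R) idfun))).
Implicit Types (phi m F : R -> R) (a b x p q k h : R).

Lemma borel_measurable_fun_lebesgue (D : set R) (f : R -> R) :
  measurable D -> measurable_fun D f ->
  @measurable_fun _ _ lebesgueR (measurableTypeR R) D f.
Proof. by move=> mD mf _ A mA; apply: borel_lebesgue_measurable; exact: mf. Qed.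

Lemma bounded_integrable_itv (f : R -> R) p q k :
  @measurable_fun _ _ lebesgueR (measurableTypeR R) `[p, q] f ->
  (forall x, x \in `[p, q] -> `|f x| <= k) ->
  mu.-integrable `[p, q] (EFin \o f).
Proof.
move=> mf fk; apply: measurable_bounded_integrable => //.
- exact: itv_lebesgue_measurable.
- have [pq|qp] := leP p q.
    by rewrite [X in (X < _)%E](completed_lebesgue_cc pq) ltry.
  by rewrite set_itv_ge ?measure0// bnd_simp -ltNge.
- exists k; split; first exact: num_real.
  by move=> r kr x /= /fk /le_trans; apply; exact: ltW.
Qed.

Lemma continuous_integrable_itv (f : R -> R) p q :
  continuous f -> mu.-integrable `[p, q] (EFin \o f).
Proof.
move=> cf; have [pq|qp] := leP p q; last first.
  by rewrite set_itv_ge ?bnd_simp -?ltNge//; exact: integrable_set0.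
have [k Hk] : exists k, forall x, x \in `[p, q] -> `|f x| <= k.
  have [|z zpq Hz] := @EVT_max R (fun x => `|f x|) p q pq.
    by apply: continuous_subspaceT => x; apply: cvg_norm; exact: cf.
  by exists `|f z|.
apply: (@bounded_integrable_itv f p q k) => //.
apply: borel_measurable_fun_lebesgue => //.
by apply: measurable_funTS; exact: continuous_measurable_fun.
Qed.

Lemma Rintegral_itv_cst k p q : p <= q -> \int[mu]_(t in `[p, q]) k = k * (q - p).
Proof.
move=> pq; rewrite Rintegral_cst; last exact: itv_lebesgue_measurable.
by rewrite [X in _ * fine X](completed_lebesgue_cc pq).
Qed.

Lemma integrable_itv_cst k p q : mu.-integrable `[p, q] (EFin \o cst k).
Proof. by apply: continuous_integrable_itv => x; exact: cst_continuous. Qed.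

Lemma Rintegral_shift_subr phi x p q k : p <= q ->
  mu.-integrable `[x + p, x + q] (EFin \o phi) ->
  \int[mu]_(y in `[x + p, x + q]) phi y - k * (q - p) =
  \int[mu]_(t in `[p, q]) (phi (x + t) - k).
Proof.
move=> pq iphi; rewrite -Rintegral_shift// -Rintegral_itv_cst// -RintegralB//.
- exact: itv_lebesgue_measurable.
- exact: integrable_shift.
- exact: integrable_itv_cst.
Qed.

Lemma integrable_shift_subr phi x p q k :
  mu.-integrable `[x + p, x + q] (EFin \o phi) ->
  mu.-integrable `[p, q] (EFin \o (fun t => phi (x + t) - k)).
Proof.
move=> iphi.
have -> : EFin \o (fun t => phi (x + t) - k) =
  ((EFin \o (fun t => phi (x + t)%R)) \- (EFin \o cst k))%E by [].
apply: integrableB; [exact: itv_lebesgue_measurable|exact: integrable_shift|].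
exact: integrable_itv_cst.
Qed.

Lemma Rintegral_itv_le_sub (f : R -> R) (p q p' q' : R) : p' <= p -> q <= q' ->
  mu.-integrable `[p', q'] (EFin \o f) -> (forall t, 0 <= f t) ->
  \int[mu]_(t in `[p, q]) f t <= \int[mu]_(t in `[p', q']) f t.
Proof.
move=> pp qq iff f0.
have sub : `[p, q] `<=` `[p', q'] by apply: subset_itv; rewrite bnd_simp.
have mI (i : interval R) := @itv_lebesgue_measurable R i.
rewrite -lee_fin /Rintegral !fineK; last 2 first.
- exact: integrable_fin_num.
- by apply: integrable_fin_num => //; apply: integrableS iff.
have mf : measurable_fun (`[p', q'] : set lebesgueR) (EFin \o f).
  by case/integrableP : iff.
have f0' t : [set` `[p', q']] t -> (0 <= (EFin \o f) t)%E.
  by move=> _; rewrite lee_fin.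
exact: (ge0_subset_integral _ (mI _) (mI _) mf f0' sub).
Qed.
End L1_calculus.

(** * Indefinite integrals of functions continuous in mean *)

Section perron_side.
Context {R : realType}.
Local Notation mu := (@completed_lebesgue_measure R).
Local Notation lebesgueR :=
  (caratheodory_type (R := R) (mu_ext (wlength (R := R) idfun))).
Implicit Types (phi m F : R -> R) (a b x p q k h : R).

Lemma in_L1_integrable a b F : in_Lr a b 1 F -> mu.-integrable `[a, b] (EFin \o F).
Proof.
move=> [mF iF]; apply/integrableP; split; first exact/measurable_EFinP.
by under eq_integral => t _ do rewrite /= -[X in X%:E](powRr1 (normr_ge0 _)).
Qed.

Lemma window_interior a b x h : a < x < b -> window a b x h = `[- h, h]%classic.
Proof. by move=> /andP[ax xb]; rewrite /window (gt_eqF ax) (lt_eqF xb). Qed.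

(** The mean of [`|phi - phi x|] over a window bounds the error of the difference
    quotient, so every point of continuity in mean is a Lebesgue point. *)
Lemma is_derive_Rintegral a b phi x : mu.-integrable `[a, b] (EFin \o phi) ->
  a < x < b -> Ls_continuous_at a b 1 phi x ->
  is_derive x 1 (fun y => \int[mu]_(t in `[a, y]) phi t) (phi x).
Proof.
move=> iphi axb cphi; apply: is_derive_eps => e e0.
have /andP[ax xb] := axb.
move: cphi => /cvgrPdist_le/(_ e e0)/near_at_right0[d d0 Hd].
exists (Num.min d (Num.min (x - a) (b - x))).
  by rewrite !lt_min d0; apply/andP; split; order_lra.
move=> h h0; rewrite !lt_min => /and3P[hd hxa hbx].
have h0' : 0 < `|h| by rewrite normr_gt0.
have mean : \int[mu]_(t in `[- `|h|, `|h|]) `|phi (x + t) - phi x| <= e * `|h|.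
  have := Hd `|h| h0' hd; rewrite sub0r normrN window_interior// invr1.
  under eq_Rintegral do rewrite powRr1//.
  have I0 : 0 <= \int[mu]_(t in `[- `|h|, `|h|]) `|phi (x + t) - phi x|.
    exact: Rintegral_ge0.
  rewrite powRr1 ?mulr_ge0 ?invr_ge0 ?(ltW h0')// ger0_norm; last first.
    by rewrite mulr_ge0// invr_ge0 ltW.
  by rewrite mulrC ler_pdivrMr.
have isub (p q : R) : - `|h| <= p -> q <= `|h| ->
    mu.-integrable `[x + p, x + q] (EFin \o phi).
  by move=> hp qh; apply: integrable_sub_itv iphi _ _; order_lra.
have bound (p q : R) : - `|h| <= p -> p <= q -> q <= `|h| ->
    `|\int[mu]_(y in `[x + p, x + q]) phi y - phi x * (q - p)| <= e * `|h|.
  move=> hp pq qh; rewrite Rintegral_shift_subr//; last exact: isub.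
  apply: le_trans (le_normr_Rintegral _ _) _.
  - exact: itv_lebesgue_measurable.
  - by apply: integrable_shift_subr; exact: isub.
  apply: le_trans mean; apply: Rintegral_itv_le_sub => //.
  have := @integrable_shift_subr R phi x (- `|h|) `|h| (phi x).
  by move=> /(_ (isub _ _ (lexx _) (lexx _))) /integrable_norm.
have [hpos|hneg] := ltP 0 h.
  rewrite (@Rintegral_itv_increment _ _ a b)//; try order_lra; last first.
    by move: hbx; rewrite gtr0_norm//; order_lra.
  have := bound 0 h; rewrite addr0 subr0 (mulrC (phi x)); apply.
  - by rewrite oppr_le0.
  - exact: ltW.
  - exact: ler_norm.
have hneg' : h < 0 by rewrite lt_neqAle h0.
have hN : `|h| = - h by rewrite ltr0_norm.
have hNle : - `|h| <= h by rewrite hN opprK.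
have hNge : h <= - `|h| by rewrite hN opprK.
have := @Rintegral_itv_increment _ phi a b (x + h) x iphi.
move=> /(_ ltac:(order_lra) ltac:(order_lra) ltac:(order_lra)) E.
have := bound h 0 ltac:(order_lra) ltac:(order_lra) ltac:(order_lra).
rewrite addr0 -E -normrN; congr (`|_| <= _); ring.
Qed.

(** The increment of [m - F] exceeds its value at [x] by at most the positive part
    that defines the derivate of [m] plus [(alpha - kappa) * t]; the latter is
    bounded by its maximum on the window before integrating. *)
Lemma right_increment_bound a b m F x alpha kappa :
  mu.-integrable `[a, b] (EFin \o m) -> mu.-integrable `[a, b] (EFin \o F) ->
  a < x < b ->
  (fun h : R => (h^-1 * \int[mu]_(t in `[0, h])
     (Num.max (m (x + t) - m x - alpha * t) 0 `^ 1)) `^ 1^-1)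
    =o_ (0^'+) (fun h : R => h) ->
  (exists2 d : R, 0 < d &
    forall t, 0 <= t -> t < d -> F x + kappa * t <= F (x + t)) ->
  forall e : R, 0 < e -> exists2 d : R, 0 < d & forall h, 0 < h -> h < d ->
    (\int[mu]_(t in `[a, x + h]) m t - \int[mu]_(t in `[a, x + h]) F t) <=
    (\int[mu]_(t in `[a, x]) m t - \int[mu]_(t in `[a, x]) F t) +
    h * (m x - F x) + (Num.max (alpha - kappa) 0 + e) * h ^+ 2.
Proof.
move=> im iF /andP[ax xb] om [d1 d10 Fd1] e e0.
have [d2 d20 Hd2] := (@littleo_right0 R _).1 om e e0.
pose d := Num.min (Num.min d1 d2) (b - x).
exists d => [|h h0]; first by rewrite !lt_min d10 d20; order_lra.
rewrite !lt_min => /andP[/andP[hd1 hd2] hb].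
set M := Num.max (alpha - kappa) 0.
pose P t := Num.max (m (x + t) - m x - alpha * t) 0.
have mI := @itv_lebesgue_measurable R `[0, h].
have imx : mu.-integrable `[x + 0, x + h] (EFin \o m).
  by apply: integrable_sub_itv im _ _; order_lra.
have iFx : mu.-integrable `[x + 0, x + h] (EFin \o F).
  by apply: integrable_sub_itv iF _ _; order_lra.
have iP : mu.-integrable `[0, h] (EFin \o P).
  have -> : EFin \o P = ((EFin \o (fun t => m (x + t) - m x)%R)
     \- (EFin \o (fun t => alpha * t)%R))^\+%E.
    apply/funext => t; rewrite funeposE /= /P -EFinB.
    by rewrite -EFin_max.
  apply: integrable_funepos => //; apply: integrableB => //.
    exact: integrable_shift_subr.
  by apply: continuous_integrable_itv => t; exact: mulrl_continuous.
have P0 : \int[mu]_(t in `[0, h]) P t <= e * h ^+ 2.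
  have := Hd2 h h0 hd2; rewrite invr1.
  under eq_Rintegral do rewrite powRr1 ?le_max ?lexx ?orbT//.
  have I0 : 0 <= \int[mu]_(t in `[0, h]) P t.
    by apply: Rintegral_ge0 => t _; rewrite le_max lexx orbT.
  rewrite -/(P _) powRr1 ?mulr_ge0 ?invr_ge0 ?(ltW h0)// ger0_norm; last first.
    by rewrite mulr_ge0// invr_ge0 ltW.
  by rewrite mulrC ler_pdivrMr// expr2 mulrA.
have Gm := @Rintegral_itv_increment _ m a b x (x + h) im
  ltac:(order_lra) ltac:(order_lra) ltac:(order_lra).
have GF := @Rintegral_itv_increment _ F a b x (x + h) iF
  ltac:(order_lra) ltac:(order_lra) ltac:(order_lra).
have Em := @Rintegral_shift_subr R m x 0 h (m x) (ltW h0) imx.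
have EF := @Rintegral_shift_subr R F x 0 h (F x) (ltW h0) iFx.
rewrite addr0 subr0 in Em EF.
suff : \int[mu]_(t in `[0, h]) (m (x + t) - m x) -
  \int[mu]_(t in `[0, h]) (F (x + t) - F x) <= e * h ^+ 2 + M * h * (h - 0).
  rewrite -Em -EF -Gm -GF subr0; order_lra.
rewrite -Rintegral_itv_cst; last exact: ltW.
apply: le_trans (lerD P0 (lexx _)).
rewrite -RintegralB//; last 2 first.
- exact: integrable_shift_subr.
- exact: integrable_shift_subr.
rewrite -RintegralD//; last exact: integrable_itv_cst.
apply: le_Rintegral => //.
- have -> : EFin \o (fun t => m (x + t) - m x - (F (x + t) - F x)) =
    ((EFin \o (fun t => m (x + t) - m x)%R) \-
     (EFin \o (fun t => F (x + t) - F x)%R))%E by [].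
  by apply: integrableB => //; exact: integrable_shift_subr.
- have -> : EFin \o (fun t => P t + M * h) =
    ((EFin \o P) \+ (EFin \o cst (M * h)%R))%E by [].
  by apply: integrableD => //; exact: integrable_itv_cst.
move=> t; rewrite /= in_itv/= => /andP[t0 th].
have := Fd1 t t0 (le_lt_trans th hd1).
have : m (x + t) - m x - alpha * t <= P t by rewrite le_max lexx.
have : (alpha - kappa) * t <= M * h.
  apply: (@le_trans _ _ (M * t)); first by rewrite ler_wpM2r// le_max lexx.
  by rewrite ler_wpM2l// le_max lexx orbT.
order_lra.
Qed.
End perron_side.

(** * Power means *)

Section power_means.
Context {R : realType}.
Local Notation mu := (@completed_lebesgue_measure R).
Local Notation lebesgueR :=
  (caratheodory_type (R := R) (mu_ext (wlength (R := R) idfun))).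
Implicit Types (phi m F f : R -> R) (a b r x p q k h : R).

Lemma measurable_fun_shift_itv F x p q :
  @measurable_fun _ _ lebesgueR (measurableTypeR R) setT F ->
  @measurable_fun _ _ lebesgueR (measurableTypeR R) `[p, q] (fun t => F (x + t)).
Proof.
move=> mF; rewrite -(shift_itv x).
apply: measurable_fun_shift; first exact: itv_lebesgue_measurable.
exact: measurable_funTS.
Qed.

Lemma measurable_fun_norm_powR phi (D : set R) r :
  @measurable_fun _ _ lebesgueR (measurableTypeR R) D phi ->
  @measurable_fun _ _ lebesgueR (measurableTypeR R) D (fun t => `|phi t| `^ r).
Proof.
move=> mphi.
apply: (measurableT_comp (f := @powR R ^~ r)); first exact: measurable_powR.
exact: (measurableT_comp (f := @Num.norm _ R)).
Qed.

(** The factor 2 absorbs the ratio of the length of the window to [h], since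
    [2 `^ r^-1 <= 2]. *)
Lemma mean_powR_le phi r h B p q : 1 <= r -> 0 < h -> 0 <= B ->
  p <= q -> q - p <= 2 * h ->
  @measurable_fun _ _ lebesgueR (measurableTypeR R) `[p, q] phi ->
  (forall t, p <= t <= q -> `|phi t| <= B) ->
  (h^-1 * \int[mu]_(t in `[p, q]) (`|phi t| `^ r)) `^ r^-1 <= 2 * B.
Proof.
move=> r1 h0 B0 pq qph mphi phiB.
have r0 : 0 < r by lra.
have bnd t : p <= t <= q -> `|phi t| `^ r <= B `^ r.
  by move=> /phiB ?; rewrite ge0_ler_powR ?nnegrE// ltW.
have I : \int[mu]_(t in `[p, q]) (`|phi t| `^ r) <= B `^ r * (2 * h).
  apply: (@le_trans _ _ (\int[mu]_(t in `[p, q]) (B `^ r))); last first.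
    by rewrite Rintegral_itv_cst// ler_wpM2l// powR_ge0.
  apply: le_Rintegral.
  - exact: itv_lebesgue_measurable.
  - apply: (@bounded_integrable_itv _ _ _ _ (B `^ r)).
      exact: measurable_fun_norm_powR.
    by move=> t; rewrite in_itv/= => /bnd; rewrite (ger0_norm (powR_ge0 _ _)).
  - exact: integrable_itv_cst.
  - by move=> t; rewrite /= in_itv/=; exact: bnd.
apply: (@le_trans _ _ ((2 * B `^ r) `^ r^-1)).
  apply: ge0_ler_powR; rewrite ?nnegrE ?invr_ge0 ?(ltW r0)//.
  - by rewrite mulr_ge0 ?invr_ge0 ?(ltW h0)//; apply: Rintegral_ge0 => t _; exact: powR_ge0.
  - by rewrite mulr_ge0 ?powR_ge0.
  - by rewrite mulrC ler_pdivrMr//; lra.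
rewrite powRM ?powR_ge0// -powRrM mulfV ?gt_eqF// powRr1//.
rewrite ler_wpM2r// -[leRHS]powRr1//; apply: ler_powR; first lra.
by rewrite invf_le1.
Qed.

Lemma continuous_Ls_continuous a b F x :
  @measurable_fun _ _ lebesgueR (measurableTypeR R) setT F ->
  a < x < b -> {for x, continuous F} -> Ls_continuous_at a b 1 F x.
Proof.
move=> mF axb cF; apply/cvgrPdist_le => e e0; apply/near_at_right0.
have e20 : 0 < e / 2 by rewrite divr_gt0.
have /cvgrPdist_le/(_ _ e20)/nbhs_ballP[d d0 Hd] := cF.
exists d => // h h0 hd; rewrite sub0r normrN window_interior//.
rewrite ger0_norm ?powR_ge0//.
have -> : e = 2 * (e / 2) by lra.
apply: mean_powR_le.
- exact: lexx.
- exact: h0.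
- exact: ltW.
- by move: h0; clear; lra.
- by clear; lra.
- have -> : (fun t => F (x + t) - F x) = (fun t => F (x + t)) \- cst (F x) by [].
  by apply: measurable_funB; [exact: measurable_fun_shift_itv|exact: measurable_cst].
move=> t th; rewrite distrC; apply: Hd => /=.
rewrite /ball/= opprD addNKr normrN (le_lt_trans _ hd)// ler_norml; lra.
Qed.

End power_means.

(** * A criterion for the absence of minor functions *)

Section no_minor_function.
Context {R : realType}.
Local Notation mu := (@completed_lebesgue_measure R).
Local Notation lebesgueR :=
  (caratheodory_type (R := R) (mu_ext (wlength (R := R) idfun))).
Implicit Types (m F f : R -> R) (a b x p q h : R).

(** A jump of [g] at [x] would, by the mean value theorem, separate the right
    difference quotients of [G] from [g x]. *)
Lemma right_continuous_of_nonincreasing_derivative (G g : R -> R) a b x :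
  a < x < b -> (forall z, a < z < b -> is_derive z 1 G (g z)) ->
  (forall y z, a < y -> y <= z -> z < b -> g z <= g y) ->
  forall e, 0 < e -> exists2 d : R, 0 < d &
    forall t, 0 < t -> t < d -> g x - e <= g (x + t).
Proof.
move=> /andP[ax xb] dG gni e e0.
have [[t0 [t00 t0b H]]|H] :=
    pselect (exists t0, [/\ 0 < t0, t0 < b - x & g x - e <= g (x + t0)]).
  exists t0 => // t tp tt; apply: le_trans H _; apply: gni; lra.
exfalso.
have dGx : is_derive x 1 G (g x) by apply: dG; lra.
have e20 : 0 < e / 2 by rewrite divr_gt0.
have [d d0 Hd] := is_deriveP_eps dGx e20.
pose h := Num.min (d / 2) ((b - x) / 2).
have h0 : 0 < h by rewrite lt_min; apply/andP; split; lra.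
have hd : h <= d / 2 by rewrite ge_min lexx.
have hb : h <= (b - x) / 2 by rewrite ge_min lexx orbT.
have [|||c] := @MVT R G g x (x + h).
- lra.
- by move=> z; rewrite in_itv/= => zxh; apply: dG; lra.
- apply: derivable_within_continuous => z; rewrite in_itv/= => zxh.
  by have [] // := dG z; lra.
rewrite in_itv/= => cxh Gc.
have := Hd h; rewrite (gtr0_norm h0) => /(_ ltac:(lra)).
rewrite Gc ler_norml => /andP[Hc _].
have gc : g c < g x - e.
  rewrite ltNge; apply/negP => gc; apply: H; exists (c - x); split; try lra.
  by rewrite subrKC.
have : h * (g c - g x + e) < 0 by rewrite pmulr_rlt0//; lra.
have : 0 < e * h by rewrite mulr_gt0.
lra.
Qed.

Lemma upper_right_derivate_lt m x (y : \bar R) :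
  (upper_right_derivate 1 m x < y)%E -> exists2 alpha : R, (alpha%:E < y)%E &
  (fun h : R => (h^-1 * \int[mu]_(t in `[0, h])
     (Num.max (m (x + t) - m x - alpha * t) 0 `^ 1)) `^ 1^-1)
    =o_ (0^'+) (fun h : R => h).
Proof. by move=> /ereal_inf_lt[_ [alpha oalpha <-] ?]; exists alpha. Qed.

Lemma upper_right_le_upper_derivate a b m x : a < x < b ->
  (upper_right_derivate 1 m x <= upper_derivate a b 1 m x)%E.
Proof.
move=> /andP[ax xb]; rewrite /upper_derivate (gt_eqF ax) (lt_eqF xb).
by move: (upper_right_derivate _ _ _) (upper_left_derivate _ _ _) => u v; rewrite le_max lexx.
Qed.

(** The hypothesis on [c] says that [F] climbs to [c] on intervals close to any
    point of [P] on the right, and that these intervals are much longer than the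
    square of their distance to the point. Monotonicity of [m - F] transfers these
    increments to [m]. *)
Lemma no_minor_function a b f F (P : set R) (c : R) : 0 < c ->
  @measurable_fun _ _ lebesgueR (measurableTypeR R) setT F ->
  mu.-integrable `[a, b] (EFin \o F) ->
  (forall x, P x -> a < x < b) -> mu.-negligible P -> ~ countable P ->
  (forall x, 0 <= F x) -> (forall x, P x -> F x = 0) ->
  (forall x, a < x < b -> ~ P x -> is_derive x 1 F (f x)) ->
  (forall x, P x -> Ls_continuous_at a b 1 F x) ->
  (forall x, P x -> forall A d : R, 0 < d -> exists p q,
    [/\ 0 < p, p < q, q < d, A * q ^+ 2 <= q - p &
        forall t, p <= t <= q -> c <= F (x + t)]) ->
  forall m, ~ minor_function a b 1 f m.
Proof.
move=> c0 mF iF Pab P0 ncP F0 FP dF LF steep m [Lm _ cm aem ctb].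
have im := in_L1_integrable Lm.
set C := [set x | _] in ctb.
pose N := P `|` [set x | ~ (x \in `[a, b] ->
  (upper_derivate a b 1 m x <= (f x)%:E)%E)].
have N0 : mu N = 0%E.
  apply: negligible_completed_lebesgue; apply: negligibleU; first exact: P0.
  exact: aem.
pose G y := \int[mu]_(t in `[a, y]) m t - \int[mu]_(t in `[a, y]) F t.
pose g y := m y - F y.
have dG z : a < z < b -> is_derive z 1 G (g z).
  move=> zab.
  have dm : is_derive z 1 (fun y => \int[mu]_(t in `[a, y]) m t) (m z).
    by apply: (is_derive_Rintegral im zab); apply: cm; rewrite in_itv/=; order_lra.
  have dF' : is_derive z 1 (fun y => \int[mu]_(t in `[a, y]) F t) (F z).
    apply: (is_derive_Rintegral iF zab).
    have [Pz|nPz] := pselect (P z); first exact: LF.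
    apply: continuous_Ls_continuous => //.
    apply: differentiable_continuous; apply/derivable1_diffP.
    by have [] := dF z zab nPz.
  exact: is_deriveB.
have ud z : z \in `[a, b] -> ~ C z -> (upper_derivate a b 1 m z < +oo)%E.
  by move=> zab nCz; apply: contrapT => nud; apply: nCz.
have lowerF z e : a < z < b -> ~ P z -> 0 < e -> exists2 d : R, 0 < d &
    forall t, 0 <= t -> t < d -> F z + (f z - e) * t <= F (z + t).
  move=> zab nPz e0; have [d d0 Hd] := is_deriveP_eps (dF z zab nPz) e0.
  exists d => // t t0 td; have := Hd t; rewrite ger0_norm// => /(_ td).
  by rewrite ler_norml => /andP[? _]; order_lra.
have gni : forall y z, a < y -> y <= z -> z < b -> g z <= g y.
  apply: (@nonincreasing_of_right_derivate R G g a b C N ctb N0 dG).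
  - move=> z zab nCz nNz e e0.
    have nPz : ~ P z by move=> Pz; apply: nNz; left.
    have zab' : z \in `[a, b] by rewrite in_itv/=; order_lra.
    have udf : (upper_derivate a b 1 m z <= (f z)%:E)%E.
      by apply: contrapT => nudf; apply: nNz; right => /(_ zab').
    have e30 : 0 < e / 3 by rewrite divr_gt0.
    have [|alpha alphaf oalpha] := @upper_right_derivate_lt m z (f z + e / 3)%:E.
      apply: le_lt_trans (upper_right_le_upper_derivate m zab) _.
      by apply: le_lt_trans udf _; rewrite lte_fin; order_lra.
    rewrite lte_fin in alphaf.
    have [d d0 Hd] := right_increment_bound im iF zab oalpha (lowerF z _ zab nPz e30) e30.
    exists d => // h h0 hd; apply: le_trans (Hd h h0 hd) _.
    rewrite lerD2l ler_wpM2r ?sqr_ge0//.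
    have : Num.max (alpha - (f z - e / 3)) 0 <= 2 * (e / 3).
      by rewrite ge_max; apply/andP; split; move: alphaf e30; clear; order_lra.
    by move: (Num.max _ _) => M; clear; order_lra.
  - move=> z zab nCz.
    have zab' : z \in `[a, b] by rewrite in_itv/=; order_lra.
    have [|alpha _ oalpha] := @upper_right_derivate_lt m z +oo%E.
      exact: le_lt_trans (upper_right_le_upper_derivate m zab) (ud z zab' nCz).
    have [kappa Hkappa] : exists kappa, exists2 d : R, 0 < d &
        forall t, 0 <= t -> t < d -> F z + kappa * t <= F (z + t).
      have [Pz|nPz] := pselect (P z).
        by exists 0, 1 => // t _ _; rewrite mul0r addr0 (FP z Pz).
      by exists (f z - 1); apply: lowerF.
    have [d d0 Hd] := right_increment_bound im iF zab oalpha Hkappa ltr01.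
    by exists (Num.max (alpha - kappa) 0 + 1), d; split.
have [x [Px nCx]] : exists x, P x /\ ~ C x.
  apply: contrapT => H; apply: ncP; apply: sub_countable ctb; apply: subset_card_le.
  by move=> x Px; apply: contrapT => nCx; apply: H; exists x.
have xab := Pab x Px.
have xab' : x \in `[a, b] by rewrite in_itv/=; order_lra.
have [|alpha _ oalpha] := @upper_right_derivate_lt m x +oo%E.
  exact: le_lt_trans (upper_right_le_upper_derivate m xab) (ud x xab' nCx).
have [d1 d10 Hd1] := (@littleo_right0 R _).1 oalpha 1 ltr01.
have c40 : 0 < c / 4 by rewrite divr_gt0.
have [d2 d20 Hd2] := right_continuous_of_nonincreasing_derivative xab dG gni c40.
have a0 : 0 < `|alpha| + 1 by rewrite ltr_wpDl.
pose d := Num.min (Num.min d1 d2) (Num.min (b - x) (c / 4 / (`|alpha| + 1))).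
have d0 : 0 < d by rewrite !lt_min d10 d20 divr_gt0// andbT; order_lra.
have [p [q [p0 pq qd qp Fc]]] := steep x Px (4 / c) d d0.
move: qd; rewrite !lt_min ltr_pdivlMr// => /andP[/andP[qd1 qd2] /andP[qb qa]].
have q0 : 0 < q by order_lra.
pose Q t := Num.max (m (x + t) - m x - alpha * t) 0.
have imx : mu.-integrable `[x + 0, x + q] (EFin \o m).
  by apply: integrable_sub_itv im _ _; order_lra.
have iQ : mu.-integrable `[0, q] (EFin \o Q).
  have -> : EFin \o Q = ((EFin \o (fun t => m (x + t) - m x)%R)
     \- (EFin \o (fun t => alpha * t)%R))^\+%E.
    apply/funext => t; rewrite funeposE /= /Q -EFinB.
    by rewrite -EFin_max.
  have mI := @itv_lebesgue_measurable R `[0, q].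
  apply: integrable_funepos => //; apply: integrableB => //.
    exact: integrable_shift_subr.
  by apply: continuous_integrable_itv => t; exact: mulrl_continuous.
have Qle : \int[mu]_(t in `[0, q]) Q t <= q ^+ 2.
  have := Hd1 q q0 qd1; rewrite invr1 mul1r.
  under eq_Rintegral do rewrite powRr1 ?le_max ?lexx ?orbT//.
  have I0 : 0 <= \int[mu]_(t in `[0, q]) Q t.
    by apply: Rintegral_ge0 => t _; rewrite le_max lexx orbT.
  rewrite -/(Q _) powRr1 ?mulr_ge0 ?invr_ge0 ?(ltW q0)// ger0_norm; last first.
    by rewrite mulr_ge0// invr_ge0 ltW.
  by rewrite mulrC ler_pdivrMr// -expr2.
have Qge : c / 2 * (q - p) <= \int[mu]_(t in `[0, q]) Q t.
  rewrite -Rintegral_itv_cst; last exact: ltW.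
  apply: (@le_trans _ _ (\int[mu]_(t in `[p, q]) Q t)); last first.
    apply: Rintegral_itv_le_sub => //; first exact: ltW.
    by move=> t; rewrite le_max lexx orbT.
  apply: le_Rintegral.
  - exact: itv_lebesgue_measurable.
  - exact: integrable_itv_cst.
  - by apply: (@integrable_sub_itv _ Q 0 q p q iQ); [exact: ltW|exact: lexx].
  move=> t; rewrite /= in_itv/= => tpq; rewrite le_max; apply/orP; left.
  have := Fc t tpq; have := Hd2 t ltac:(order_lra) ltac:(order_lra); rewrite /g (FP x Px).
  have : alpha * t <= c / 4.
    apply: (@le_trans _ _ (`|alpha| * q)); last first.
      by apply: le_trans (ltW qa); rewrite mulrC ler_wpM2l ?(ltW q0)//; order_lra.
    apply: (@le_trans _ _ (`|alpha| * t)); first by rewrite ler_wpM2r ?ler_norm//; order_lra.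
    by rewrite ler_wpM2l//; order_lra.
  order_lra.
have Qq := le_trans Qge Qle.
have : c * (4 / c * q ^+ 2) <= c * (q - p) by rewrite ler_wpM2l// ltW.
have -> : c * (4 / c * q ^+ 2) = 4 * q ^+ 2 by field; rewrite gt_eqF.
have : 0 < q ^+ 2 by rewrite exprn_gt0.
order_lra.
Qed.
End no_minor_function.

(** * The dust *)

Section nodes.
Context {R : realType}.
Variable kappa : R.
Hypotheses (kappa0 : 0 < kappa) (kappa32 : kappa <= 32^-1).
Local Notation mu := (@completed_lebesgue_measure R).
Local Notation lebesgueR :=
  (caratheodory_type (R := R) (mu_ext (wlength (R := R) idfun))).
Implicit Types (n : nat) (x y q L : R) (s : seq R).

(** The exponent [n ^ 2] makes the ratio of consecutive lengths tend to 0, while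
    [len n.+1] still dominates [len n ^+ 2]. *)
Definition len n : R := kappa ^+ (n ^ 2).

Lemma len_gt0 n : 0 < len n. Proof. exact: exprn_gt0. Qed.

Lemma lenS n : len n.+1 = kappa ^+ (2 * n + 1) * len n.
Proof.
rewrite /len -exprD; congr (_ ^+ _).
by rewrite -addn1 sqrnD muln1 exp1n -addnA addnC [(1 + _)%N]addnC.
Qed.

Lemma lenS_le n : 32 * len n.+1 <= len n.
Proof.
rewrite lenS addn1 exprS; set k := kappa ^+ _.
have k01 : 0 <= k <= 1.
  rewrite exprn_ge0 ?(ltW kappa0)// exprn_ile1 ?(ltW kappa0)//.
  by apply: le_trans kappa32 _; lra.
have l0 := len_gt0 n.
have lk : 0 <= len n * k by apply: mulr_ge0; lra.
have lk1 : len n * k <= len n by apply: ler_piMr; lra.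
have : (len n * k) * (32 * kappa) <= len n * k.
  by apply: ler_piMr => //; rewrite -ler_pdivlMl// mulr1.
lra.
Qed.

Lemma len_le n : len n <= 32^-1 ^+ n.
Proof.
elim: n => [|n IH]; first by rewrite /len !expr0.
by rewrite exprS; have := lenS_le n; lra.
Qed.

Fixpoint nodes n : seq R :=
  if n is k.+1 then nodes k ++ map (fun q => q + len k) (nodes k) else [:: 0].

Lemma size_nodes n : size (nodes n) = (2 ^ n)%N.
Proof. by elim: n => //= n IH; rewrite size_cat size_map IH expnS mul2n addnn. Qed.

Lemma mem_nodesS n q : (q \in nodes n.+1) =
  (q \in nodes n) || (q - len n \in nodes n).
Proof.
rewrite mem_cat; congr (_ || _); apply/mapP/idP => [[u un ->]|].
  by rewrite addrK.
by exists (q - len n) => //; rewrite subrK.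
Qed.

Lemma nodesS_parent n q : q \in nodes n.+1 ->
  exists2 u, u \in nodes n & q = u \/ q = u + len n.
Proof.
rewrite mem_nodesS => /orP[qn|qn]; first by exists q => //; left.
by exists (q - len n) => //; right; rewrite subrK.
Qed.

(** Nodes with a common parent differ by [len n]; the others stay apart because
    passing to the next stage moves them by at most [len n]. *)
Lemma nodes_separated n q u : q \in nodes n -> u \in nodes n -> q != u ->
  16 * len n <= `|q - u|.
Proof.
elim: n q u => [|n IH] q u.
  by rewrite /= !inE => /eqP -> /eqP ->; rewrite eqxx.
move=> /nodesS_parent[q' q'n Eq] /nodesS_parent[u' u'n Eu] qu.
have l0 := len_gt0 n; have lS := lenS_le n; have lS0 := len_gt0 n.+1.
have [E|q'u'] := eqVneq q' u'; last first.
  have := IH _ _ q'n u'n q'u'.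
  by case: Eq Eu => [->|->] [->|->]; rewrite !ler_normr => /orP[H|H];
    apply/orP; [left|right|left|right|left|right|left|right]; lra.
move: Eq Eu qu; rewrite E => -[->|->] [->|->] => /eqP qu //; rewrite ler_normr;
  apply/orP; [right|left]; lra.
Qed.

Definition itv_cover s L : set R := [set x | exists2 q, q \in s & q <= x <= q + L].

Lemma itv_cover_nil L : itv_cover [::] L = set0.
Proof. by apply/seteqP; split => x // -[]. Qed.

Lemma itv_cover_cons q s L : itv_cover (q :: s) L = `[q, q + L] `|` itv_cover s L.
Proof.
apply/seteqP; split => x.
  move=> [u]; rewrite inE => /predU1P[->|us] ux; first by left; rewrite /= in_itv.
  by right; exists u.
move=> [|[u us ux]]; last by exists u => //; rewrite inE us orbT.
by rewrite /= in_itv/= => qx; exists q => //; rewrite mem_head.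
Qed.

Lemma closed_itv_cover s L : closed (itv_cover s L).
Proof.
elim: s => [|q s IH]; first by rewrite itv_cover_nil; exact: closed0.
by rewrite itv_cover_cons; apply: closedU => //; exact: itv_closed.
Qed.

Lemma measurable_itv_cover s L : @measurable _ lebesgueR (itv_cover s L).
Proof.
apply: borel_lebesgue_measurable.
elim: s => [|q s IH]; first by rewrite itv_cover_nil; exact: measurable0.
by rewrite itv_cover_cons; apply: measurableU.
Qed.

Lemma completed_lebesgue_itv_cover s L : 0 <= L ->
  (mu (itv_cover s L) <= ((size s)%:R * L)%:E)%E.
Proof.
move=> L0; elim: s => [|q s IH].
  by rewrite itv_cover_nil measure0 mul0r.
rewrite itv_cover_cons; apply: le_trans (measureU2 _ _ _) _.
- exact: itv_lebesgue_measurable.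
- exact: measurable_itv_cover.
rewrite /= -natr1 mulrDl mul1r addrC EFinD; apply: leeD => //.
rewrite [X in (X <= _)%E](completed_lebesgue_cc _) ?lee_fin; lra.
Qed.

(** The factor 4 makes room for the bumps of stage [n], up to [q + 4 * len n]. *)
Definition stage n := itv_cover (nodes n) (4 * len n).

Definition dust : set R := \bigcap_n stage n.

(** The children of [q] stay in the left half of its interval, so that the bump of
    [q] avoids all later stages. *)
Lemma stageS_node n x : stage n.+1 x ->
  exists2 q, q \in nodes n & q <= x <= q + 2 * len n.
Proof.
move=> [q /nodesS_parent[u un Eq] qx]; exists u => //.
have := lenS_le n; have := len_gt0 n; have := len_gt0 n.+1.
by case: Eq qx => ->; lra.
Qed.

Lemma stage_subset n j : (n <= j)%N -> stage j `<=` stage n.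
Proof.
move=> /subnK <-; elim: (j - n)%N => // k IH x.
rewrite addSn => /stageS_node[q qn qx]; apply: IH; exists q => //.
by have := len_gt0 (k + n); lra.
Qed.

Lemma dust_node n x : dust x ->
  exists2 q, q \in nodes n & q <= x <= q + 2 * len n.
Proof. by move=> Px; apply: stageS_node; exact: Px. Qed.

Lemma dust_itv x : dust x -> 0 <= x <= 2.
Proof.
move=> /(dust_node 0)[q]; rewrite /= inE => /eqP ->.
by rewrite /len expr0; lra.
Qed.

Lemma closed_dust : closed dust.
Proof. by apply: closed_bigI => n _; exact: closed_itv_cover. Qed.

Lemma dust_null : mu dust = 0%E.
Proof.
apply/eqP; rewrite eq_le completed_lebesgue_ge0 andbT.
apply/lee_addgt0Pr => e e0; rewrite add0e.
have : (16^-1 : R) ^+ n @[n --> \oo] --> 0.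
  by apply: cvg_expr; rewrite ger0_norm; lra.
have e40 : 0 < e / 4 by rewrite divr_gt0.
move=> /cvgrPdist_le/(_ _ e40)[n _ /(_ n (leqnn n))].
rewrite sub0r normrN ger0_norm ?exprn_ge0// => ne.
have sub : dust `<=` stage n by move=> x; exact.
apply: le_trans (le_completed_lebesgue sub) _.
apply: le_trans (completed_lebesgue_itv_cover _ _) _.
  by have := len_gt0 n; lra.
rewrite lee_fin size_nodes natrX.
have : 2 ^+ n * len n <= 2 ^+ n * 32^-1 ^+ n by rewrite ler_wpM2l ?exprn_ge0 ?len_le.
rewrite -exprMn (_ : 2 * 32^-1 = 16^-1 :> R); last by field.
by move: (2 ^+ n) (len n) ne => u v ne; lra.
Qed.

(** Given an injective numbering of the dust, choose nested intervals: at step [n]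
    the first child is kept unless it contains the point of number [n], in which case
    the second child, disjoint from the first one, is taken. The common point of
    these intervals has no number. *)
Lemma dust_uncountable : ~ countable dust.
Proof.
move=> /countable_injP[f injf].
pose hit n q := `[< exists x, [/\ dust x, f x = n & q <= x <= q + 4 * len n.+1] >].
pose fix Q n := if n is k.+1 then if hit k (Q k) then Q k + len k else Q k else 0.
have Qnode n : Q n \in nodes n.
  elim: n => [|n IH]; first by rewrite /= inE.
  rewrite mem_nodesS /=; case: (hit n (Q n)); last by rewrite IH.
  by rewrite addrK IH orbT.
have QS n : Q n <= Q n.+1 /\ Q n.+1 + 2 * len n.+1 <= Q n + 2 * len n.
  have := lenS_le n; have := len_gt0 n; have := len_gt0 n.+1.
  by rewrite /=; case: (hit n (Q n)); split; lra.
have Qmono n j : Q n <= Q (j + n)%N /\ Q (j + n)%N + 2 * len (j + n) <= Q n + 2 * len n.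
  elim: j => [|j [IH1 IH2]]; first by rewrite add0n.
  have [H1 H2] := QS (j + n)%N.
  by split; [exact: le_trans H1|exact: le_trans IH2].
have Qub n : ubound (range Q) (Q n + 2 * len n).
  move=> _ [j _ <-]; have l0 := len_gt0 n; have [jn|nj] := leqP j n.
    by have [+ _] := Qmono j (n - j)%N; rewrite subnK//; lra.
  have [_] := Qmono n (j - n)%N; rewrite subnK 1?ltnW//.
  by have := len_gt0 j; lra.
have supQ : has_sup (range Q).
  by split; [exists (Q 0%N), 0%N|exists (Q 0%N + 2 * len 0)].
pose x := sup (range Q).
have Qx n : Q n <= x <= Q n + 2 * len n.
  apply/andP; split; last exact: ge_sup (supQ.1) (Qub n).
  by apply: ub_le_sup; [exact: supQ.2|exists n].
have Px : dust x.
  move=> n _; exists (Q n) => //.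
  by have := Qx n; have := len_gt0 n; lra.
have := Qx (f x).+1; have := lenS_le (f x); have := len_gt0 (f x); have := len_gt0 (f x).+1.
rewrite /=; case: ifPn => [/asboolP[y [Py fy]]|/asboolPn H].
  have -> : y = x by apply: injf; rewrite ?inE.
  lra.
by move=> ? ? ? ?; apply: H; exists x; split=> //; lra.
Qed.
End nodes.

(** * The hump function *)

Section bumps.
Context {R : realType}.
Implicit Types (x v c w h : R).

Definition sqr_pos v : R := (Num.max v 0) ^+ 2.

Lemma is_derive_sqr_pos v : is_derive v 1 sqr_pos (2 * Num.max v 0).
Proof.
apply: is_derive_eps => e e0; exists e => // h _ he.
have bound : `|sqr_pos (v + h) - sqr_pos v - h * (2 * Num.max v 0)| <= h ^+ 2.
  rewrite /sqr_pos ler_norml.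
  case: (leP v 0) => v0; case: (leP (v + h) 0) => vh0; apply/andP; split; nra.
apply: le_trans bound _.
by rewrite -(real_normK (num_real h)) expr2 ler_wpM2r// ltW.
Qed.

(** The square of the positive part is differentiable also at 0, hence the profile
    is differentiable at the ends of its support. *)
Definition bump c w x : R := sqr_pos (1 - ((x - c) / w) ^+ 2).

Lemma bump_ge0 c w x : 0 <= bump c w x.
Proof. exact: sqr_ge0. Qed.

Lemma bump_neq0 c w x : 0 < w -> bump c w x != 0 -> c - w < x < c + w.
Proof.
move=> w0; rewrite /bump /sqr_pos; case: (leP (1 - ((x - c) / w) ^+ 2) 0) => [_|y0 _].
  by rewrite expr0n eqxx.
have y : x = c + (x - c) / w * w by rewrite divfK ?gt_eqF//; ring.
move: y0 y; set y := (x - c) / w => y0 ->.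
have : - 1 < y < 1 by apply/andP; split; nra.
move=> /andP[y1 y2]; apply/andP; split; nra.
Qed.

Lemma bump_core c w x : 0 < w -> c - w / 2 <= x <= c + w / 2 -> 2^-1 <= bump c w x.
Proof.
move=> w0 xc; rewrite /bump /sqr_pos.
have y : x - c = (x - c) / w * w by rewrite divfK ?gt_eqF//.
set t := (x - c) / w in y *.
have t1 : t <= 1 / 2 by rewrite -(ler_pM2r w0) -y; lra.
have t2 : - (1 / 2) <= t by rewrite -(ler_pM2r w0) -y; lra.
have tt : t ^+ 2 <= 1 / 4 by nra.
by rewrite (max_idPl _); nra.
Qed.

Lemma derivable_bump c w x : derivable (bump c w) x 1.
Proof.
have dq : is_derive x 1 (fun y : R => 1 - ((y - c) / w) ^+ 2)
    (- (2 * ((x - c) / w) * w^-1)).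
  by apply: is_derive_eq; rewrite /GRing.scale/=; ring.
have ds := is_derive_sqr_pos (1 - ((x - c) / w) ^+ 2).
by have [] := @is_derive1_comp _ sqr_pos _ x _ _ ds dq.
Qed.
End bumps.

Section hump_function.
Context {R : realType}.
Variable kappa : R.
Hypotheses (kappa0 : 0 < kappa) (kappa32 : kappa <= 32^-1).
Local Notation mu := (@completed_lebesgue_measure R).
Local Notation lebesgueR :=
  (caratheodory_type (R := R) (mu_ext (wlength (R := R) idfun))).
Local Notation len := (len kappa).
Local Notation nodes := (nodes kappa).
Local Notation stage := (stage kappa).
Local Notation dust := (dust kappa).
Implicit Types (n N : nat) (x y : R).

Definition level n x : R :=
  \sum_(q <- nodes n) bump (q + 3 * len n) (len n.+1) x.

Lemma level_ge0 n x : 0 <= level n x.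
Proof. by apply: sumr_ge0 => q _; exact: bump_ge0. Qed.

Lemma level_neq0 n x : level n x != 0 -> exists2 q, q \in nodes n &
  q + 3 * len n - len n.+1 < x < q + 3 * len n + len n.+1.
Proof.
move=> lx; apply: contrapT => H; move/eqP : lx; apply.
rewrite /level big_seq big1// => q qn; apply/eqP; apply: contrapT => /negP bq.
by apply: H; exists q => //; apply: bump_neq0 bq; exact: len_gt0.
Qed.

Lemma level_neq0_stage n x : level n x != 0 -> stage n x.
Proof.
move=> /level_neq0[q qn qx]; exists q => //.
have := lenS_le kappa0 kappa32 n; have := len_gt0 kappa0 n.
have := len_gt0 kappa0 n.+1; lra.
Qed.

(** The dust that belongs to [q] lies on the left of the bump; the other nodes are
    separated from [q]. *)
Lemma level_dust_far n q x : q \in nodes n -> dust x ->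
  x < q + 3 * len n - len n.+1 - len n / 2 \/ q + 3 * len n + len n.+1 + len n / 2 < x.
Proof.
move=> qn Px; have [u un ux] := dust_node kappa0 kappa32 n Px.
have := lenS_le kappa0 kappa32 n; have := len_gt0 kappa0 n.
have := len_gt0 kappa0 n.+1 => lS0 l0 lS.
have [uq|uq] := eqVneq q u; first by left; move: ux; rewrite -uq; lra.
have := nodes_separated kappa0 kappa32 qn un uq.
by rewrite ler_normr => /orP[H|H]; [left|right]; lra.
Qed.

Lemma level_dust0 n x : dust x -> level n x = 0.
Proof.
move=> Px; apply/eqP; apply: contrapT => /negP/level_neq0[q qn qx].
by have := len_gt0 kappa0 n; case: (level_dust_far qn Px); lra.
Qed.

Lemma derivable_level n x : derivable (level n) x 1.
Proof.
rewrite /level; elim: (nodes n) => [|q s IH].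
  rewrite (_ : (fun _ => _) = cst 0); first exact: derivable_cst.
  by apply/funext => y; rewrite big_nil.
rewrite (_ : (fun _ => _) = bump (q + 3 * len n) (len n.+1) +
  (fun y => \sum_(q <- s) bump (q + 3 * len n) (len n.+1) y)).
  by apply: derivableD => //; exact: derivable_bump.
by apply/funext => y; rewrite big_cons.
Qed.

Definition partial N x : R := \sum_(n < N) level n x.

Lemma derivable_partial N x : derivable (partial N) x 1.
Proof.
rewrite (_ : partial N = \sum_(n < N) level n); last first.
  by apply/funext => y; rewrite /partial fct_sumE.
by apply: derivable_sum => n; exact: derivable_level.
Qed.

Lemma partial_ge0 N x : 0 <= partial N x.
Proof. by apply: sumr_ge0 => n _; exact: level_ge0. Qed.

Definition total x : R := limn (fun N => partial N x).

Lemma total_partial N x : (forall n, (N <= n)%N -> level n x = 0) ->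
  total x = partial N x.
Proof.
move=> H; apply: lim_near_cst => //; exists N => // M /= NM.
rewrite /partial -!(big_mkord predT (level ^~ x)) (big_cat_nat (n := N))//=.
have -> : \sum_(N <= n < M) level n x = 0 by rewrite big_nat_cond big1// => n /andP[/andP[/H]].
by rewrite addr0.
Qed.

Lemma total_stage N x : ~ stage N x -> total x = partial N x.
Proof.
move=> sx; apply: total_partial => n Nn; apply/eqP; apply: contrapT => /negP.
move=> /level_neq0_stage /(stage_subset kappa0 kappa32 Nn); exact: sx.
Qed.

Lemma total_dust x : dust x -> total x = 0.
Proof.
move=> Px; rewrite (@total_partial 0) ?/partial ?big_ord0// => n _.
exact: level_dust0.
Qed.

Lemma not_dust x : ~ dust x -> exists N, ~ stage N x.
Proof.
move=> nPx; apply: contrapT => H; apply: nPx => N _.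
by apply: contrapT => ?; apply: H; exists N.
Qed.

Lemma total_partialE x : exists N, (forall n, (N <= n)%N -> level n x = 0) /\ total x = partial N x.
Proof.
have [Px|/not_dust[N sx]] := pselect (dust x).
  exists 0%N; split; first by move=> n _; exact: level_dust0.
  by apply: total_partial => n _; exact: level_dust0.
exists N; split; last exact: total_stage.
move=> n Nn; apply/eqP; apply: contrapT => /negP.
move=> /level_neq0_stage /(stage_subset kappa0 kappa32 Nn); exact: sx.
Qed.

Lemma total_ge0 x : 0 <= total x.
Proof. by have [N [_ ->]] := total_partialE x; exact: partial_ge0. Qed.

Lemma level_le_total n x : level n x <= total x.
Proof.
have [N [HN ->]] := total_partialE x.
have [nN|Nn] := ltnP n N; last by rewrite HN// partial_ge0.
rewrite /partial (bigD1 (Ordinal nN))//= lerDl.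
by apply: sumr_ge0 => k _; exact: level_ge0.
Qed.

(** The quotient keeps the values in the unit interval, so that powers of [hump] are
    bounded by the indicator of its support. *)
Definition hump x : R := total x / (1 + total x).

Lemma hump_ge0 x : 0 <= hump x.
Proof. by have := total_ge0 x => ?; rewrite divr_ge0//; lra. Qed.

Lemma hump_le1 x : hump x <= 1.
Proof. by have := total_ge0 x => ?; rewrite ler_pdivrMr; lra. Qed.

Lemma hump_dust x : dust x -> hump x = 0.
Proof. by move=> Px; rewrite /hump total_dust// mul0r. Qed.

Lemma hump_eq0 x : (forall n, level n x = 0) -> hump x = 0.
Proof.
move=> H; rewrite /hump (@total_partial 0%N)//.
by rewrite /partial big_ord0 mul0r.
Qed.

Lemma hump_core n q x : q \in nodes n ->
  q + 3 * len n - len n.+1 / 2 <= x <= q + 3 * len n + len n.+1 / 2 ->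
  3^-1 <= hump x.
Proof.
move=> qn xq.
have b : 2^-1 <= bump (q + 3 * len n) (len n.+1) x.
  by apply: bump_core => //; exact: len_gt0.
have : 2^-1 <= total x.
  apply: le_trans (level_le_total n x); rewrite /level (big_rem q)//=.
  by rewrite -[leLHS]addr0 lerD// sumr_ge0// => u _; exact: bump_ge0.
by move=> t; have := total_ge0 x => ?; rewrite ler_pdivlMr; lra.
Qed.

(** A point outside the dust is outside some stage, which is closed and contains all
    later bumps; so the sum is locally finite. *)
Lemma derivable_hump x : ~ dust x -> derivable hump x 1.
Proof.
move=> /not_dust[N sx].
have near_x : \forall y \near x, partial N y / (1 + partial N y) = hump y.
  have : \forall y \near x, (~` stage N) y.
    by apply: open_nbhs_nbhs; split=> //; apply: closed_openC; exact: closed_itv_cover.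
  by apply: filterS => y sy; rewrite /hump (total_stage sy).
apply: near_eq_derivable near_x _.
have p0 := partial_ge0 N x.
have dp : derivable (partial N) x 1 by exact: derivable_partial.
apply: derivableM => //; apply: derivableV; first by rewrite gt_eqF//; lra.
by apply: derivableD => //; exact: derivable_cst.
Qed.

Lemma measurable_hump : @measurable_fun _ _ lebesgueR (measurableTypeR R) setT hump.
Proof.
apply: borel_measurable_fun_lebesgue => //.
have mP : measurable dust by apply: closed_measurable; exact: closed_dust.
rewrite -(setUv dust); apply/measurable_funU => //; first exact: measurableC.
split.
  apply: eq_measurable_fun (measurable_cst (0 : R)) => x.
  by rewrite inE => Px; rewrite hump_dust.
apply: open_continuous_measurable_fun.
  by apply: closed_openC; exact: closed_dust.
move=> x; rewrite inE => nPx; apply: differentiable_continuous.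
by apply/derivable1_diffP; exact: derivable_hump.
Qed.
End hump_function.

(** * The hump function is AC on the dust *)

Section hump_AC.
Context {R : realType}.
Variable kappa : R.
Hypotheses (kappa0 : 0 < kappa) (kappa32 : kappa <= 32^-1).
Local Notation mu := (@completed_lebesgue_measure R).
Local Notation lebesgueR :=
  (caratheodory_type (R := R) (mu_ext (wlength (R := R) idfun))).
Local Notation len := (len kappa).
Local Notation nodes := (nodes kappa).
Local Notation stage := (stage kappa).
Local Notation dust := (dust kappa).
Local Notation level := (level kappa).
Local Notation hump := (hump kappa).
Implicit Types (n N : nat) (x y c d r s : R).

Lemma len_antimono n j : (n <= j)%N -> len j <= len n.
Proof.
move=> /subnK <-; elim: (j - n)%N => // k IH; apply: le_trans IH.
rewrite addSn; have := lenS_le kappa0 kappa32 (k + n).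
by have := len_gt0 kappa0 (k + n).+1; lra.
Qed.

Definition ends n : seq R :=
  [seq q + 3 * len n - len n.+1 | q <- nodes n] ++
  [seq q + 3 * len n + len n.+1 | q <- nodes n].

Lemma size_ends n : size (ends n) = (2 * 2 ^ n)%N.
Proof. by rewrite size_cat !size_map size_nodes mul2n addnn. Qed.

(** A point of the dust is at distance at least [len n / 2] from the bump, and on the
    way from that point to [y] the interval crosses an end of the bump. *)
Lemma level_neq0_ends n x y c d : c < d -> dust x -> x \in `[c, d] ->
  y \in `[c, d] -> level n y != 0 ->
  len n / 2 <= d - c /\ exists2 e, e \in ends n & c < e < d.
Proof.
rewrite !in_itv/= => cd Px xcd ycd /(level_neq0 kappa0)[q qn qy].
have l0 := len_gt0 kappa0 n; have lS0 := len_gt0 kappa0 n.+1.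
have [H|H] := level_dust_far kappa0 kappa32 qn Px.
  split; first by lra.
  exists (q + 3 * len n - len n.+1); last by lra.
  by rewrite mem_cat; apply/orP; left; apply/mapP; exists q.
split; first by lra.
exists (q + 3 * len n + len n.+1); last by lra.
by rewrite mem_cat; apply/orP; right; apply/mapP; exists q.
Qed.

(** Once a bump of stage [n] is met, those of later stages are estimated together by
    the intervals of stage [n.+1]; all pieces have the length [4 * len n.+1]. *)
Definition shadow n : set R :=
  itv_cover (nodes n.+1 ++ [seq q + 3 * len n - len n.+1 | q <- nodes n])
    (4 * len n.+1).

Lemma hump_neq0_shadow n y : (forall j, (j < n)%N -> level j y = 0) ->
  ~ shadow n y -> hump y = 0.
Proof.
move=> lev0 ny; apply: hump_eq0 => j.
have [jn|nj] := ltnP j n; first exact: lev0.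
apply/eqP; apply: contrapT => /negP lj; apply: ny.
have lS0 := len_gt0 kappa0 n.+1.
move: nj; rewrite leq_eqVlt => /predU1P[E|nj]; last first.
  have [q qn qy] := stage_subset kappa0 kappa32 nj (level_neq0_stage kappa0 kappa32 lj).
  by exists q => //; rewrite mem_cat qn.
have [q qn qy] := level_neq0 kappa0 lj; rewrite -E in qn qy.
exists (q + 3 * len n - len n.+1); last by lra.
by rewrite mem_cat; apply/orP; right; apply/mapP; exists q.
Qed.

Lemma completed_lebesgue_shadow n : (mu (shadow n) <= (12 * 2 ^+ n * len n.+1)%:E)%E.
Proof.
have l0 := len_gt0 kappa0 n.+1.
apply: le_trans (completed_lebesgue_itv_cover _ _) _; first by lra.
rewrite lee_fin size_cat size_map !size_nodes expnS natrD natrM natrX.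
by rewrite le_eqVlt; apply/orP; left; apply/eqP; ring.
Qed.

Lemma integrable_hump_powR c d x s : 1 <= s -> dust x ->
  mu.-integrable `[c, d] (EFin \o (fun y => `|hump y - hump x| `^ s)).
Proof.
move=> s1 Px; apply: (@bounded_integrable_itv _ _ _ _ 1).
  apply: measurable_fun_norm_powR; apply: measurable_funTS.
  have -> : (fun y => hump y - hump x) = hump \- cst (hump x) by [].
  by apply: measurable_funB; [exact: measurable_hump|exact: measurable_cst].
move=> y _; rewrite (hump_dust kappa0 kappa32 Px) subr0 (ger0_norm (powR_ge0 _ _)).
apply: (@le_trans _ _ (1 `^ s)); last by rewrite powR1.
  rewrite ge0_ler_powR ?nnegrE//; first by lra.
by rewrite ger0_norm ?hump_ge0 ?hump_le1.
Qed.

(** The power of [hump] is at most the indicator of [shadow n], of measure at most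
    [12 * 2 ^+ n * len n.+1], while the length of the interval is at least
    [len n / 2]. The quotient is at most [kappa ^+ n]. *)
Lemma hump_mean_le s n x y c d : 1 <= s -> kappa <= 32^-1 `^ s ->
  c < d -> dust x -> x \in `[c, d] -> y \in `[c, d] -> level n y != 0 ->
  (forall j z, (j < n)%N -> z \in `[c, d] -> level j z = 0) ->
  ((d - c)^-1 * \int[mu]_(z in `[c, d]) (`|hump z - hump x| `^ s)) `^ s^-1
    <= 32^-1 ^+ n.
Proof.
move=> s1 ks cd Px xcd ycd ly lev0.
have s0 : 0 < s by lra.
have [ldc _] := level_neq0_ends cd Px xcd ycd ly.
have l0 := len_gt0 kappa0 n; have lS0 := len_gt0 kappa0 n.+1.
have mW : @measurable _ lebesgueR (shadow n) by exact: measurable_itv_cover.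
have mI := @itv_lebesgue_measurable R `[c, d].
have I : \int[mu]_(z in `[c, d]) (`|hump z - hump x| `^ s) <= 12 * 2 ^+ n * len n.+1.
  have ii : mu.-integrable `[c, d] (EFin \o (\1_(shadow n) : R -> R)).
    apply: (@bounded_integrable_itv _ _ _ _ 1).
      by apply: measurable_funTS; exact: measurable_indic.
    by move=> z _; rewrite indicE; case: (_ \in _); rewrite ?normr1 ?normr0.
  apply: (@le_trans _ _ (\int[mu]_(z in `[c, d]) \1_(shadow n) z)).
    apply: le_Rintegral => //; first exact: integrable_hump_powR.
    move=> z; rewrite /= => zcd; rewrite (hump_dust kappa0 kappa32 Px) subr0.
    rewrite indicE; case: (boolP (z \in shadow n)) => [_|]/=.
      apply: (@le_trans _ _ (1 `^ s)); last by rewrite powR1.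
  rewrite ge0_ler_powR ?nnegrE//; first by lra.
      by rewrite ger0_norm ?hump_ge0 ?hump_le1.
    move=> /negP nz; have -> : hump z = 0.
      apply: (@hump_neq0_shadow n) => [j jn|sz]; first exact: lev0.
      by apply: nz; rewrite inE.
    by rewrite normr0 powR0// gt_eqF.
  rewrite -lee_fin /Rintegral fineK; last exact: integrable_fin_num.
  rewrite integral_indic//; apply: le_trans (completed_lebesgue_shadow n).
  by apply: le_completed_lebesgue => z [].
have ratio : (d - c)^-1 * \int[mu]_(z in `[c, d]) (`|hump z - hump x| `^ s) <= kappa ^+ n.
  rewrite mulrC ler_pdivrMr ?subr_gt0//; apply: le_trans I _.
  apply: (@le_trans _ _ (kappa ^+ n * (len n / 2))); last first.
    by rewrite ler_wpM2l// exprn_ge0// ltW.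
  rewrite lenS mul2n -addnn addn1 exprS exprD.
  have k0 : 0 < kappa ^+ n by rewrite exprn_gt0.
  have k1 : 32 * kappa <= 1 by rewrite -ler_pdivlMl// mulr1.
  have k20 : 0 <= 2 * kappa by rewrite mulr_ge0// ltW.
  have k21 : 2 * kappa <= 1 by clear -k1 kappa0; lra.
  have k2 : 0 <= 2 ^+ n * kappa ^+ n <= 1.
    by rewrite -exprMn exprn_ge0 ?exprn_ile1.
  have kl : 0 <= kappa ^+ n * len n by rewrite mulr_ge0// ltW.
  have K : 12 * kappa * (2 ^+ n * kappa ^+ n) <= 1 / 2.
    move/andP: k2 => [_ k2].
    apply: (@le_trans _ _ (12 * kappa * 1)); last by clear -k1; lra.
    by rewrite ler_wpM2l// mulr_ge0// ltW.
  have := ler_wpM2r kl K.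
  by move: (2 ^+ n) (kappa ^+ n) (len n) => u v w; clear; lra.
have -> : 32^-1 ^+ n = ((32^-1 ^+ n) `^ s) `^ s^-1 :> R.
  by rewrite -powRrM mulfV ?gt_eqF// powRr1// exprn_ge0.
apply: ge0_ler_powR; rewrite ?nnegrE ?invr_ge0 ?(ltW s0) ?powR_ge0//.
  rewrite mulr_ge0 ?invr_ge0 ?subr_ge0 ?(ltW cd)//.
  by apply: Rintegral_ge0 => z _; exact: powR_ge0.
apply: le_trans ratio _.
have -> : (32^-1 ^+ n) `^ s = (32^-1 `^ s) ^+ n :> R.
  have i0 : 0 <= 32^-1 :> R by rewrite invr_ge0.
  by rewrite -(powR_mulrn n i0) -powRrM mulrC powRrM powR_mulrn ?powR_ge0.
by rewrite lerXn2r ?nnegrE ?powR_ge0// ltW.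
Qed.

(** The mean is charged to an end of a bump of the first stage met by the interval,
    and a short interval meets late stages only. *)
Lemma hump_mean_charge s N x c d : 1 <= s -> kappa <= 32^-1 `^ s ->
  c < d -> dust x -> x \in `[c, d] -> d - c < len N / 2 ->
  exists2 n, (N <= n)%N &
  ((d - c)^-1 * \int[mu]_(z in `[c, d]) (`|hump z - hump x| `^ s)) `^ s^-1
    <= \sum_(e <- ends n) (c < e < d)%R%:R * 32^-1 ^+ n.
Proof.
move=> s1 ks cd Px xcd dcN.
have [[n0 [y [ycd ly]]]|H] :=
  pselect (exists n y, y \in `[c, d] /\ level n y != 0); last first.
  exists N => //; rewrite (@eq_Rintegral _ _ _ _ _ (cst 0)); last first.
    move=> z; rewrite inE /= => zcd.
    rewrite (hump_dust kappa0 kappa32 Px) subr0 hump_eq0.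
      by rewrite normr0 powR0// gt_eqF//; lra.
    move=> n; apply/eqP; apply: contrapT => /negP lz.
    by apply: H; exists n, z.
  rewrite Rintegral_itv_cst; last exact: ltW.
  rewrite mul0r mulr0 powR0; last by rewrite invr_eq0 gt_eqF//; lra.
  by apply: sumr_ge0 => e _; rewrite mulr_ge0// exprn_ge0.
pose met n := `[< exists y, y \in `[c, d] /\ level n y != 0 >].
have exmet : exists n, met n by exists n0; apply/asboolP; exists y.
case: (ex_minnP exmet) => n /asboolP[z [zcd lz]] nmin.
have [ldc [e en ecd]] := level_neq0_ends cd Px xcd zcd lz.
exists n.
  rewrite leqNgt; apply/negP => /ltnW /len_antimono; lra.
apply: le_trans (hump_mean_le s1 ks cd Px xcd zcd lz _) _.
  move=> j u jn ucd; apply/eqP; apply: contrapT => /negP lu.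
  have : met j by apply/asboolP; exists u.
  by move=> /nmin; rewrite leqNgt jn.
rewrite (big_rem e)//= ecd mul1r -[leLHS]addr0 lerD// sumr_ge0// => u _.
Qed.

Lemma sum_ends_le N M : (N <= M)%N ->
  \sum_(N <= n < M) \sum_(e <- ends n) (32^-1 ^+ n : R) <= 4 * 16^-1 ^+ N.
Proof.
move=> NM.
have -> : \sum_(N <= n < M) \sum_(e <- ends n) (32^-1 ^+ n : R) =
    \sum_(N <= n < M) 2 * 16^-1 ^+ n.
  apply: eq_bigr => n _; rewrite big_const_seq count_predT size_ends.
  rewrite iter_addr_0 -[LHS]mulr_natl natrM natrX -mulrA -exprMn.
  by congr (2 * _ ^+ n); field.
suff : \sum_(N <= n < M) 2 * 16^-1 ^+ n <= 4 * (16^-1 ^+ N - 16^-1 ^+ M) :> R.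
  have : 0 <= 16^-1 ^+ M :> R by rewrite exprn_ge0.
  by move: (\sum_(_ <= _ < _) _) => u; lra.
rewrite -(subnK NM); elim: (M - N)%N => [|k IH].
  by rewrite add0n big_geq// subrr mulr0.
rewrite addSn big_nat_recr ?leq_addl//= exprS.
have : 0 <= 16^-1 ^+ (k + N) :> R by rewrite exprn_ge0.
by move: IH; set u := \sum_(_ <= _ < _) _; lra.
Qed.

(** A constant gauge suffices. After exchanging the sums, each end of a bump is
    charged by at most one of the nonoverlapping intervals. *)
Lemma AC_hump a b s : 1 <= s -> kappa <= 32^-1 `^ s -> AC_on a b s hump dust.
Proof.
move=> s1 ks eps eps0.
(* Stage n has 2 * 2 ^ n ends, each charged 32^-n. *)
have [N HN] : exists N, 4 * 16^-1 ^+ N < eps.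
  have : (16^-1 : R) ^+ n @[n --> \oo] --> 0.
    by apply: cvg_expr; rewrite ger0_norm; lra.
  have e50 : 0 < eps / 5 by rewrite divr_gt0.
  move=> /cvgrPdist_le/(_ _ e50)[n _ /(_ n (leqnn n))].
  rewrite sub0r normrN ger0_norm ?exprn_ge0// => ne.
  by exists n; lra.
have lN := len_gt0 kappa0 N.
exists (fun=> len N / 4); first by move=> *; lra.
move=> k c d x cd tcd Hx.
have charge i := @hump_mean_charge s N (x i) (c i) (d i) s1 ks.
have {charge} /choice[lev Hlev] : forall i, exists n, (N <= n)%N /\
    ((d i - c i)^-1 * \int[mu]_(z in `[c i, d i]) (`|hump z - hump (x i)| `^ s)) `^ s^-1
    <= \sum_(e <- ends n) (c i < e < d i)%R%:R * 32^-1 ^+ n.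
  move=> i; have [_ cdi _] := cd i; have [Px xcd sub] := Hx i.
  have [|n Nn Hn] := charge i cdi Px xcd; last by exists n.
  have /sub : `[c i, d i]%classic (c i) by rewrite /= in_itv/= lexx ltW.
  have /sub : `[c i, d i]%classic (d i) by rewrite /= in_itv/= lexx ltW.
  by rewrite /= !in_itv/=; lra.
pose M := (\max_(i < k) lev i).+1.
have levM i : (N <= lev i < M)%N.
  by rewrite (Hlev i).1 ltnS; exact: (leq_bigmax i).
apply: le_lt_trans HN.
have [NM|MN] := leqP N M; last first.
  rewrite big1 ?mulr_ge0 ?exprn_ge0// => i _.
  by have /andP[] := levM i; lia.
apply: le_trans (sum_ends_le NM).
apply: (@le_trans _ _ (\sum_(i < k) \sum_(N <= n < M) \sum_(e <- ends n)
    (c i < e < d i)%R%:R * 32^-1 ^+ n)).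
  apply: ler_sum => i _; apply: le_trans (Hlev i).2 _.
  have /andP[Nl lM] := levM i.
  rewrite (big_cat_nat Nl (ltnW lM))/= [X in _ + X](big_ltn lM).
  have pos u v : 0 <= \sum_(u <= n < v) \sum_(e <- ends n) (c i < e < d i)%R%:R * 32^-1 ^+ n :> R.
    by apply: sumr_ge0 => n _; apply: sumr_ge0 => e _; rewrite mulr_ge0// exprn_ge0.
  have := pos N (lev i); have := pos (lev i).+1 M.
  by move: (\sum_(_ <= _ < _) _) (\sum_(_ <= _ < _) _) => u v; lra.
rewrite exchange_big/=; apply: ler_sum => n _.
rewrite exchange_big/=; apply: ler_sum => e _.
rewrite -mulr_suml ler_piMl ?exprn_ge0//.
have [[i ei]|H] := pselect (exists i, c i < e < d i); last first.
  rewrite big1// => i _; have [ei|//] := boolP (c i < e < d i).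
  by exfalso; apply: H; exists i.
rewrite (bigD1 i)//= ei big1 ?addr0// => j ji.
have [ej|//] := boolP (c j < e < d j); exfalso.
move/trivIsetP : tcd => /(_ i j I I); rewrite eq_sym => /(_ ji).
move=> /seteqP[/(_ e) + _]; apply; split; rewrite /= in_itv//.
Qed.
End hump_AC.

(** * Integrability in the sense of Henstock and Kurzweil, and the counterexample *)

Section HK_side.
Context {R : realType}.
Local Notation mu := (@completed_lebesgue_measure R).
Local Notation lebesgueR :=
  (caratheodory_type (R := R) (mu_ext (wlength (R := R) idfun))).
Implicit Types (a b r x : R) (F : R -> R) (E : set R).

Lemma AC_on_Ls_continuous a b F E x : mu.-integrable `[a, b] (EFin \o F) ->
  AC_on a b 1 F E -> E x -> a < x < b -> Ls_continuous_at a b 1 F x.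
Proof.
move=> iF acF Ex axb; have /andP[ax xb] := axb.
apply/cvgrPdist_le => e e0; apply/near_at_right0.
have [delta delta0 Hdelta] := acF (e / 2) ltac:(lra).
have dx := delta0 x Ex.
exists (Num.min (delta x) (Num.min (x - a) (b - x))).
  by rewrite !lt_min dx; apply/andP; split; lra.
move=> h h0; rewrite !lt_min => /and3P[hd hxa hxb].
have := Hdelta 1%N (fun=> x - h) (fun=> x + h) (fun=> x).
move=> /(_ _ _ _)/wrap[].
- by move=> _; split; lra.
- by apply/trivIsetP => i j _ _; rewrite (ord1 i) (ord1 j) eqxx.
- move=> _; split=> //; first by rewrite in_itv/=; lra.
  by move=> y; rewrite /= !in_itv/=; lra.
rewrite big_ord1 sub0r normrN window_interior//.
rewrite invr1 ger0_norm ?powR_ge0//.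
have ish : mu.-integrable `[x + - h, x + h] (EFin \o F).
  by apply: integrable_sub_itv iF _ _; lra.
have inorm : mu.-integrable `[x + - h, x + h]
    (EFin \o (fun y => `|F y - F x| `^ 1)).
  have -> : EFin \o (fun y => `|F y - F x| `^ 1) =
      (abse \o ((EFin \o F) \- (EFin \o cst (F x))))%E.
    by apply/funext => y /=; rewrite powRr1.
  apply: integrable_abse; apply: integrableB => //.
    exact: itv_lebesgue_measurable.
  exact: integrable_itv_cst.
have := @Rintegral_shift R (fun y => `|F y - F x| `^ 1) x (- h) h inorm.
move=> ->; set I := Rintegral _ _ _.
have I0 : 0 <= I by apply: Rintegral_ge0 => y _; exact: powR_ge0.
have -> : x + h - (x - h) = 2 * h by ring.
rewrite invfM -mulrA powRr1 ?mulr_ge0 ?invr_ge0 ?(ltW h0)// => H.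
rewrite powRr1 ?mulr_ge0 ?invr_ge0 ?(ltW h0)//.
by move: (h^-1 * I) H => u; clear; lra.
Qed.

(** Differentiability bounds the integrand uniformly on the window. *)
Lemma is_derive_Lr_derivative a b r F x k : 1 <= r -> a < b ->
  @measurable_fun _ _ lebesgueR (measurableTypeR R) setT F ->
  is_derive x 1 F k -> Lr_derivative_at a b r F x k.
Proof.
move=> r1 ab mF dF; apply/littleo_right0 => e e0.
have e20 : 0 < e / 2 by rewrite divr_gt0.
have [d d0 Hd] := is_deriveP_eps dF e20.
exists d => // h h0 hd; rewrite ger0_norm ?powR_ge0//.
have -> : e * h = 2 * (e / 2 * h) by field.
have B0 : 0 <= e / 2 * h by rewrite mulr_ge0// ltW.
have mphi (p q : R) : @measurable_fun _ _ lebesgueR (measurableTypeR R) `[p, q]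
    (fun t => F (x + t) - F x - k * t).
  have -> : (fun t => F (x + t) - F x - k * t) =
    ((fun t => F (x + t)) \- cst (F x)) \- (fun t => k * t) by [].
  apply: measurable_funB.
    by apply: measurable_funB; [exact: measurable_fun_shift_itv|exact: measurable_cst].
  apply: borel_measurable_fun_lebesgue => //; apply: measurable_funTS.
  by apply: continuous_measurable_fun => t; exact: mulrl_continuous.
have bound t : - h <= t <= h -> `|F (x + t) - F x - k * t| <= e / 2 * h.
  move=> th; rewrite (mulrC k).
  have th' : `|t| <= h by rewrite ler_norml.
  apply: le_trans (Hd t _) _; first exact: le_lt_trans hd.
  by rewrite ler_wpM2l// ltW.
have mean (p q : R) : p <= q -> - h <= p -> q <= h ->
    (h^-1 * \int[mu]_(t in `[p, q]) (`|F (x + t) - F x - k * t| `^ r)) `^ r^-1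
      <= 2 * (e / 2 * h).
  move=> pq hp qh; apply: (mean_powR_le r1 h0 B0 pq _ (mphi p q)).
    by move: hp qh; clear; lra.
  move=> t tpq; apply: bound; move: tpq hp qh; clear; lra.
rewrite /window; case: ifP => _; last case: ifP => _; apply: mean;
  by rewrite ?lexx ?oppr_le0 ?oppr_ge0 ?ge0_cp ?(ltW h0)//; move: h0; clear; lra.
Qed.
End HK_side.

Section hump_example.
Context {R : realType}.
Variable kappa : R.
Hypotheses (kappa0 : 0 < kappa) (kappa32 : kappa <= 32^-1).
Local Notation mu := (@completed_lebesgue_measure R).
Local Notation dust := (dust kappa).
Local Notation hump := (hump kappa).
Local Notation len := (len kappa).

Lemma dust_negligible : mu.-negligible dust.
Proof.
exists dust; split=> //; last exact: dust_null.
apply: borel_lebesgue_measurable; apply: closed_measurable.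
exact: closed_dust.
Qed.

Lemma integrable_hump (a b : R) : mu.-integrable `[a, b] (EFin \o hump).
Proof.
apply: (@bounded_integrable_itv _ _ _ _ 1).
  by apply: measurable_funTS; exact: measurable_hump.
by move=> y _; rewrite ger0_norm ?hump_ge0 ?hump_le1.
Qed.

Lemma hump_in_Lr (a b r : R) : 1 <= r -> in_Lr a b r hump.
Proof.
move=> r1; split; first by apply: measurable_funTS; exact: measurable_hump.
have : mu.-integrable `[a, b] (EFin \o (fun x => `|hump x| `^ r)).
  apply: (@bounded_integrable_itv _ _ _ _ 1).
    apply: measurable_fun_norm_powR; apply: measurable_funTS.
    exact: measurable_hump.
  move=> y _; rewrite (ger0_norm (powR_ge0 _ _)).
  apply: (@le_trans _ _ (1 `^ r)); last by rewrite powR1.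
  rewrite ge0_ler_powR ?nnegrE//; first by lra.
  by rewrite ger0_norm ?hump_ge0 ?hump_le1.
move=> /integrableP[_]; apply: le_lt_trans.
rewrite le_eqVlt; apply/orP; left; apply/eqP; apply: eq_integral => x _ /=.
by rewrite (ger0_norm (powR_ge0 _ _)).
Qed.

Lemma hump_HK (a b r : R) : 1 <= r -> kappa <= 32^-1 `^ r -> a <= 0 -> 2 <= b ->
  HK_integrable a b r (fun x => 'D_1 hump x).
Proof.
move=> r1 kr a0 b2; exists hump, dust; split.
- exact: hump_in_Lr.
- by move=> x /(dust_itv kappa0 kappa32); rewrite /= in_itv/=; lra.
- exact: dust_negligible.
- move=> x _ nPx; apply: is_derive_Lr_derivative => //; first lra.
    exact: measurable_hump.
  by apply/derivableP; exact: derivable_hump.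
- exact: AC_hump.
Qed.

(** The core of the bump at stage [n] has length [len n.+1] and lies at distance at
    most [4 * len n], and [len n.+1 = kappa ^+ (2 * n + 1) * len n] exceeds any given
    multiple of [len n ^+ 2] for large [n]. *)
Lemma hump_steep x A d : dust x -> 0 < d -> exists p q,
  [/\ 0 < p, p < q, q < d, A * q ^+ 2 <= q - p &
      forall t, p <= t <= q -> 3^-1 <= hump (x + t)].
Proof.
move=> Px d0.
have kcvg : kappa ^+ n @[n --> \oo] --> 0.
  apply: cvg_expr; rewrite ger0_norm ?(ltW kappa0)//.
  by apply: le_lt_trans kappa32 _; lra.
have A0 : 0 < 16 * (`|A| + 1) by rewrite mulr_gt0// ltr_wpDl.
have e0 : 0 < Num.min (d / 5) (16 * (`|A| + 1))^-1.
  by rewrite lt_min divr_gt0//= invr_gt0.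
move: kcvg => /cvgrPdist_le/(_ _ e0)[N _ HN].
(* From n = 4 on, 3 n + 1 <= n ^ 2. *)
pose n := (N + 4)%N.
have := HN n; rewrite /= leq_addr sub0r normrN ger0_norm ?exprn_ge0 ?(ltW kappa0)//.
move=> /(_ isT); rewrite le_min => /andP[nd nA].
have k01 : 0 <= kappa <= 1.
  by rewrite ltW//=; apply: le_trans kappa32 _; lra.
have kmono i j : (i <= j)%N -> kappa ^+ j <= kappa ^+ i.
  by move=> ij; have /andP[? ?] := k01; exact: ler_wiXn2l.
have ln : len n <= kappa ^+ n.
  by apply: kmono; rewrite /n; nia.
have lS : 16 * (`|A| + 1) * len n <= kappa ^+ (2 * n + 1).
  have : len n <= kappa ^+ n * kappa ^+ (2 * n + 1).
    by rewrite -exprD; apply: kmono; rewrite /n; nia.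
  have : 16 * (`|A| + 1) * kappa ^+ n <= 1 by rewrite mulrC -ler_pdivlMr// mul1r.
  move=> H1 H2.
  apply: (@le_trans _ _ (16 * (`|A| + 1) * (kappa ^+ n * kappa ^+ (2 * n + 1)))).
    by rewrite ler_wpM2l// ltW.
  by rewrite mulrA ler_piMl// exprn_ge0// ltW.
have l0 := len_gt0 kappa0 n; have lS0 := len_gt0 kappa0 n.+1.
have l32 := lenS_le kappa0 kappa32 n.
have [q qn qx] := dust_node kappa0 kappa32 n Px.
exists (q + 3 * len n - len n.+1 / 2 - x), (q + 3 * len n + len n.+1 / 2 - x).
split; [lra|lra|lra| |]; last first.
  by move=> t tx; apply: (hump_core kappa0 kappa32 qn); lra.
set u := (q + _ + _ - x).
have u0 : 0 <= u <= 4 * len n by rewrite /u; lra.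
apply: (@le_trans _ _ (len n.+1)); last by rewrite /u; lra.
rewrite lenS; have u2 : u ^+ 2 <= 16 * len n ^+ 2.
  have -> : 16 * len n ^+ 2 = (4 * len n) ^+ 2 by ring.
  by rewrite lerXn2r ?nnegrE//; lra.
apply: (@le_trans _ _ ((`|A| + 1) * u ^+ 2)).
  by rewrite ler_wpM2r ?sqr_ge0//; have := ler_norm A; lra.
apply: (@le_trans _ _ ((`|A| + 1) * (16 * len n ^+ 2))).
  by rewrite ler_wpM2l// ltW// ltr_wpDl.
by have := ler_wpM2r (ltW l0) lS; lra.
Qed.
End hump_example.

Theorem theorem3 (R : realType) (r : R) (hr : 1 <= r) :
  exists (a b : R) (f : R -> R),
    [/\ a < b, HK_integrable a b r f & ~ Perron_integrable a b 1 f].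
Proof.
pose kappa : R := 32^-1 `^ r.
have kappa0 : 0 < kappa by rewrite powR_gt0.
have kappa32 : kappa <= 32^-1.
  rewrite -[leRHS]powRr1 ?invr_ge0//; apply: ger_powR => //.
  by apply/andP; split; lra.
exists (- 1), 3, (fun x => 'D_1 (hump kappa) x); split; first lra.
  by apply: hump_HK => //; lra.
have nominor := @no_minor_function R (- 1) 3 (fun x => 'D_1 (hump kappa) x)
  (hump kappa) (dust kappa) 3^-1.
have ac1 : AC_on (- 1) 3 1 (hump kappa) (dust kappa).
  by apply: AC_hump => //; rewrite powRr1// invr_ge0.
have Pab x : dust kappa x -> - 1 < x < 3.
  by move=> /(dust_itv kappa0 kappa32); lra.
move=> /(_ 1 ltr01)[M [m [_ minor _]]]; move: minor; apply: nominor => //.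
- exact: measurable_hump.
- exact: integrable_hump.
- exact: dust_negligible.
- exact: dust_uncountable.
- exact: hump_ge0.
- exact: hump_dust.
- by move=> x _ nPx; apply/derivableP; exact: derivable_hump.
- move=> x Px; apply: AC_on_Ls_continuous ac1 Px (Pab x Px).
  exact: integrable_hump.
- by move=> x Px A d; exact: hump_steep.
Qed.
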